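(* For every integer $n\ge 3$ we have $\lim_{d\to\infty}\frac{\lambda(n,d)}{d}=0$.
   Context: For $n\ge1$, let $\mathbb{S}^n_{n+2}$ denote the standard triangulation of the $n$-sphere with $n+2$ vertices, i.e. the boundary of the $(n+1)$-simplex (all proper subsets of an $(n+2)$-element vertex set). For a simplicial map $f:K\to L$ between finite simplicial complexes whose geometric realizations are oriented $n$-spheres, the degree $\deg f$ is the integer $d$ such that $f_*:H_n(|K|;\mathbb{Z})\cong\mathbb{Z}\to\mathbb{Z}\cong H_n(|L|;\mathbb{Z})$ is multiplication by $d$. For positive integers $n,d$, $\lambda(n,d)$ is the minimal number of vertices of a finite simplicial complex $K$ whose geometric realization $|K|$ is homeomorphic to $\mathbb{S}^n$ and which admits a simplicial map $K\to\mathbb{S}^n_{n+2}$ of degree $d$. *)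

(* Defs.v *)
From mathcomp Require Import all_boot all_order all_fingroup all_algebra.

Set Implicit Arguments.
Unset Strict Implicit.
Unset Printing Implicit Defensive.

Import Order.TTheory GRing.Theory Num.Theory.
Local Open Scope ring_scope.

(* Simplices are identified with their vertex sets, and the empty simplex
   belongs to every complex. *)
Definition is_complex (V : finType) (K : {set {set V}}) : Prop :=
  set0 \in K /\ forall s t : {set V}, s \in K -> t \subset s -> t \in K.

Definition std_sphere (n : nat) : {set {set 'I_n.+2}} :=
  [set s : {set 'I_n.+2} | s \proper [set: 'I_n.+2]].

Definition is_simplicial (V W : finType) (K : {set {set V}})
    (L : {set {set W}}) (f : V -> W) : Prop :=
  forall s : {set V}, s \in K -> f @: s \in L.

(* Oriented integral simplicial chains.  A chain on k vertices (dimension k - 1)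
   is an alternating function of ordered k-tuples of vertices, supported on the
   tuples spanning a simplex; its value at t is the coefficient of the oriented
   simplex [t_0, ..., t_(k-1)].  Alternation in int makes it vanish on every
   tuple with a repeated vertex. *)
Notation chain V k := {ffun {ffun 'I_k -> V} -> int}.

Definition is_chain (V : finType) (K : {set {set V}}) (k : nat)
    (c : chain V k) : Prop :=
  (forall (t : {ffun 'I_k -> V}) (s : 'S_k),
     c [ffun i => t (s i)] = (-1) ^+ s * c t) /\
  (forall t : {ffun 'I_k -> V}, c t != 0 -> [set t i | i : 'I_k] \in K).

Definition cons_tuple (V : finType) (k : nat) (v : V)
    (t : {ffun 'I_k -> V}) : {ffun 'I_k.+1 -> V} :=
  [ffun i => if unlift ord0 i is Some j then t j else v].

(* The linear map sending [t_0, ..., t_k] to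
   \sum_i (-1)^i [t_0, ..., ^t_i, ..., t_k], read on coefficients: the oriented
   simplices having t as the i-th face are those obtained by inserting a vertex
   v at position i, and (-1)^i is the sign of moving v to the front.  For k = 0
   this is the augmentation. *)
Definition boundary (V : finType) (k : nat) (c : chain V k.+1) : chain V k :=
  [ffun t => \sum_(v : V) c (cons_tuple v t)].

(* The linear map sending [t_0, ..., t_(k-1)] to [f t_0, ..., f t_(k-1)], which
   is 0 if two of the vertices f t_i coincide, read on coefficients. *)
Definition pushforward (V W : finType) (f : V -> W) (k : nat)
    (c : chain V k) : chain W k :=
  [ffun u => \sum_(t : {ffun 'I_k -> V} | [ffun i => f (t i)] == u) c t].

Definition is_cycle (V : finType) (K : {set {set V}}) (n : nat)
    (c : chain V n.+1) : Prop :=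
  is_chain K c /\ boundary c = 0.

Definition is_boundary (V : finType) (K : {set {set V}}) (n : nat)
    (c : chain V n.+1) : Prop :=
  exists2 b : chain V n.+2, is_chain K b & c = boundary b.

(* The class of the n-cycle z is a free generator of H_n(K; Z), that is,
   k |-> k [z] is an isomorphism from Z to H_n(K; Z).  Here n >= 1: in
   dimension 0 the cycles above are those of reduced homology. *)
Definition is_orientation (V : finType) (K : {set {set V}}) (n : nat)
    (z : chain V n.+1) : Prop :=
  is_cycle K z /\
  forall c : chain V n.+1, is_cycle K c ->
    exists! k : int, is_boundary K (c - z *~ k).

(* f_* [z] = d [w] in H_n(L; Z), where z and w orient K and L. *)
Definition has_degree (V W : finType) (K : {set {set V}}) (L : {set {set W}})
    (f : V -> W) (n : nat) (z : chain V n.+1) (w : chain W n.+1)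
    (d : int) : Prop :=
  [/\ is_orientation K z, is_orientation L w &
      is_boundary L (pushforward f z - w *~ d)].

From mathcomp Require Import all_classical all_reals all_analysis.
Import numFieldNormedType.Exports.
Local Open Scope classical_set_scope.

Definition homeomorphic (X Y : topologicalType) (A : set X) (B : set Y)
    : Prop :=
  exists f : X -> Y, exists g : Y -> X,
    [/\ {within A, continuous f} /\ {within B, continuous g},
        (forall x, A x -> B (f x)), (forall y, B y -> A (g y)),
        (forall x, A x -> g (f x) = x) & (forall y, B y -> f (g y) = y)].

(* Barycentric coordinates: vertex v is the v-th standard basis vector. *)
Definition realization (R : realType) (m : nat) (K : {set {set 'I_m}})
    : set 'rV[R]_m :=
  [set x : 'rV[R]_m | [/\ forall v : 'I_m, 0 <= x ord0 v,
                          \sum_(v < m) x ord0 v = 1 &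
                          [set v | x ord0 v != 0]%SET \in K]].
Arguments realization R {m} K _.

Definition unit_sphere (R : realType) (n : nat) : set 'rV[R]_n.+1 :=
  [set x : 'rV[R]_n.+1 | \sum_(i < n.+1) x ord0 i ^+ 2 = 1].
Arguments unit_sphere R n _ : clear implicits.

(* The orientations of K and of the standard sphere may be chosen freely;
   reversing either one changes the sign of the degree. *)
Definition realizes_degree (R : realType) (n d m : nat) : Prop :=
  exists K : {set {set 'I_m}}, exists f : 'I_m -> 'I_n.+2,
  exists z : chain 'I_m n.+1, exists w : chain 'I_n.+2 n.+1,
    [/\ is_complex K,
        (forall v : 'I_m, [set v]%SET \in K),
        homeomorphic (realization R K) (unit_sphere R n),
        is_simplicial K (std_sphere n) f &
        has_degree K (std_sphere n) f z w d%:Z].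

(* A minimum of natural numbers, with value +oo if there is no such m. *)
Definition lambda (R : realType) (n d : nat) : \bar R :=
  ereal_inf [set (m%:R)%:E | m in [set m : nat | realizes_degree R n d m]].

(* Main.v *)
(* The join [C_a * C_b] of an [a]-gon and a [b]-gon is a 3-sphere with [a + b]
   vertices but [a b] facets.  Labelling the vertices of the first polygon so
   that it winds [N] times around the triangle 012 and [r] times around 013, and
   those of the second so that it winds [q] times around 034 and once around
   042, exactly [N q + r] facets, counted with sign, are mapped to the facet
   1234; so the labelling, which is automatically simplicial, has degree
   [N q + r].  With [N] fixed, [q = d / N] and [r = d mod N] this takes
   [3 d / N + O(1)] vertices.  Suspending [n - 3] times, with one pole labelled
   by the new vertex, adds [2 (n - 3)] vertices and keeps the degree.

   A complex is recognised as a sphere by a homogeneous homeomorphism from the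
   cone over it onto a Euclidean space; such homeomorphisms multiply under
   joins.  Its orientation is a top-dimensional cycle such that a cycle vanishing
   on one facet vanishes; this too is inherited by joins. *)

(* A map of degree [d] has at least [d] facets of [K] over each facet of the standard sphere, so a
   sublinear number of vertices requires spheres whose facets far outnumber their vertices. A
   2-sphere with [m] vertices has only [2 m - 4] triangles; dimension 3 is the first where a
   quadratic number occurs. In a join the count factors: the coefficient over 1234 is bilinear in
   the labelled edges of the two polygons. The windings 012 and 034 alone yield only multiples of
   [N]. The remainder is carried by 013 and 042 because the mixed pairs, 12 with 42 and 13 with 34,
   repeat a label, so no cross terms arise. Homology reduces to cycles: an [n]-dimensional complex
   has no chains in dimension [n + 1], so homologous top cycles are equal and the degree is a single
   coefficient of the pushed-forward cycle. *)
Require Import Defs.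
From mathcomp Require Import all_boot all_order all_fingroup all_algebra.
From mathcomp Require Import zify.

Set Implicit Arguments.
Unset Strict Implicit.
Unset Printing Implicit Defensive.

Import Order.TTheory GRing.Theory Num.Theory.
Local Open Scope ring_scope.

(** * Oriented simplices *)

(* The coefficient at [t] of the oriented simplex [F_0, ..., F_(k-1)]; a
   determinant, so that alternation and the boundary formula come for free. *)
Definition osimp (V : eqType) (k : nat) (F t : 'I_k -> V) : int :=
  \det (\matrix_(i, j) (t i == F j)%:R).

Definition fcons (V : Type) (k : nat) (v : V) (t : 'I_k -> V) : 'I_k.+1 -> V :=
  fun i => if unlift ord0 i is Some j then t j else v.

Definition fcat (V : Type) (k1 k2 : nat) (t : 'I_k1 -> V) (s : 'I_k2 -> V) :
    'I_(k1 + k2) -> V :=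
  fun i => match split i with inl a => t a | inr b => s b end.

Lemma fcons0 (V : Type) k (v : V) (t : 'I_k -> V) : fcons v t ord0 = v.
Proof. by rewrite /fcons unlift_none. Qed.

Lemma fconsS (V : Type) k (v : V) (t : 'I_k -> V) i : fcons v t (lift ord0 i) = t i.
Proof. by rewrite /fcons liftK. Qed.

Lemma fcatl (V : Type) k1 k2 (t : 'I_k1 -> V) (s : 'I_k2 -> V) i :
  fcat t s (lshift k2 i) = t i.
Proof. by rewrite /fcat (unsplitK (inl i : 'I_k1 + 'I_k2)). Qed.

Lemma fcatr (V : Type) k1 k2 (t : 'I_k1 -> V) (s : 'I_k2 -> V) i :
  fcat t s (rshift k1 i) = s i.
Proof. by rewrite /fcat (unsplitK (inr i : 'I_k1 + 'I_k2)). Qed.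

Section Osimp.
Variables (V : eqType) (k : nat).
Implicit Types (F t : 'I_k -> V).

Lemma eq_osimp F F' t t' : F =1 F' -> t =1 t' -> osimp F t = osimp F' t'.
Proof. by move=> eF et; congr (\det _); apply/matrixP=> i j; rewrite !mxE eF et. Qed.

Lemma osimp_perm F t (s : 'S_k) :
  osimp F (fun i => t (s i)) = (-1) ^+ s * osimp F t.
Proof.
rewrite -det_perm -det_mulmx -row_permE; congr (\det _).
by apply/matrixP=> i j; rewrite !mxE.
Qed.

Lemma osimp_tr F t : osimp F t = osimp t F.
Proof. by rewrite /osimp -det_tr; congr (\det _); apply/matrixP=> i j; rewrite !mxE eq_sym. Qed.

Lemma osimp_notin F t i : (forall j, t i != F j) -> osimp F t = 0.
Proof.
move=> h; rewrite /osimp (expand_det_row _ i) big1 // => j _.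
by rewrite mxE (negPf (h j)) mul0r.
Qed.

Lemma osimp_rep F t j1 j2 : j1 != j2 -> F j1 = F j2 -> osimp F t = 0.
Proof.
move=> j12 e; rewrite osimp_tr /osimp; apply: (determinant_alternate j12) => i.
by rewrite !mxE e.
Qed.

Lemma osimp_self F : injective F -> osimp F F = 1.
Proof.
move=> Fi; rewrite -[RHS](det1 _ k); congr (\det _).
by apply/matrixP=> i j; rewrite !mxE (inj_eq Fi).
Qed.

Lemma osimp_inj (W : eqType) (h : V -> W) F t :
  injective h -> osimp (h \o F) (h \o t) = osimp F t.
Proof. by move=> hi; congr (\det _); apply/matrixP=> i j; rewrite !mxE /= (inj_eq hi). Qed.

Lemma osimp_sum F t :
  osimp F t = \sum_(s : 'S_k) (-1) ^+ s * [forall i, t i == F (s i)]%:R.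
Proof.
apply: eq_bigr => s _; congr (_ * _).
case: forallP => [h|h].
  by rewrite big1 // => i _; rewrite mxE h.
have [i hi] : exists i, t i != F (s i).
  by apply/existsP; rewrite -negb_forall; apply/forallP.
by rewrite (bigD1 i) //= mxE (negPf hi) mul0r.
Qed.

End Osimp.

(** The matrix is block upper triangular: no entry of [s] occurs in [F], so the lower left block
    vanishes, whatever [t] shares with [G]. *)
Lemma osimp_fcat (V : eqType) k1 k2 (F t : 'I_k1 -> V) (G s : 'I_k2 -> V) :
  (forall i j, s i != F j) ->
  osimp (fcat F G) (fcat t s) = osimp F t * osimp G s.
Proof.
move=> h; rewrite /osimp.
rewrite -(det_ublock _ (\matrix_(i, j) (t i == G j)%:R)); congr (\det _).
apply/matrixP=> i j; rewrite !mxE.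
case: (split_ordP i) => a -> ; rewrite ?fcatl ?fcatr !mxE;
  case: (split_ordP j) => b ->; rewrite ?fcatl ?fcatr !mxE //.
by rewrite (negPf (h _ _)).
Qed.

(** Laplace expansion along the row of [v]: in the sum over [v] the column of [F j] contributes only
    at [v = F j], and the minors are the faces of [F]. *)
Lemma sum_osimp_fcons (V : finType) k (F : 'I_k.+1 -> V) (t : 'I_k -> V) :
  \sum_v osimp F (fcons v t)
    = \sum_(j < k.+1) (-1) ^+ j * osimp (fun i => F (lift j i)) t.
Proof.
under eq_bigr => v _ do rewrite /osimp (expand_det_row _ ord0).
rewrite exchange_big; apply: eq_bigr => j _ /=.
rewrite (bigD1 (F j)) //= big1 => [|v hv]; last first.
  by rewrite mxE fcons0 (negPf hv) mul0r.
rewrite mxE fcons0 eqxx mul1r addr0 /cofactor add0n; congr (_ * \det _).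
by apply/matrixP=> a b; rewrite !mxE fconsS.
Qed.

(* Expanding along the columns outside the image of [c] reduces the sum to the
   minors of the columns [c]. *)
Lemma sum_det_eq0 (X : Type) (L : seq (int * X)) k (N : nat) (c : 'I_k -> 'I_N)
    (M : X -> 'M[int]_N) :
  injective c ->
  (forall x y i j, j \notin codom c -> M x i j = M y i j) ->
  (forall x i j, j \notin codom c -> val i = 0%N -> M x i j = 0) ->
  (forall g : 'I_k -> 'I_N, (exists i, val (g i) = 0%N) ->
     \sum_(x <- L) x.1 * \det (\matrix_(i, j) M x.2 (g i) (c j)) = 0) ->
  (k > 0)%N ->
  \sum_(x <- L) x.1 * \det (M x.2) = 0.
Proof.
move=> ci hM hM0 hg k0; elim: N => [|N IH] in c M ci hM hM0 hg *.
  by case: (c (Ordinal k0)).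
case: (pickP [pred j | j \notin codom c]) => [j0 /= hj0 | hc].
  case: L hM hg IH => [|x0 L']; first by rewrite big_nil.
  set L := _ :: L' => hM hg IH.
  under eq_bigr => x _ do rewrite (expand_det_col _ j0) big_distrr /=.
  rewrite exchange_big big1 //= => i _.
  under eq_bigr => x _ do rewrite (hM x.2 x0.2 _ _ hj0) mulrCA.
  rewrite -big_distrr /=.
  (* Row 0 is zero in column [j0], so only other rows are deleted and row 0 remains row 0 of the
     minor, as the induction requires. *)
  have [i0|i0] := posnP (val i); first by rewrite hM0 // mul0r.
  rewrite /cofactor; under eq_bigr => x _ do rewrite mulrCA.
  rewrite -big_distrr /=.
  have cj j : {b | c j = lift j0 b}.
    case: (unliftP j0 (c j)) => [b e|e]; first by exists b.
    by case/negP: hj0; rewrite -e codom_f.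
  pose c' j := sval (cj j).
  have c'E j : c j = lift j0 (c' j) by rewrite /c'; case: (cj j).
  have cod j : j \notin codom c' -> lift j0 j \notin codom c.
    apply: contra => /codomP [b]; rewrite c'E => /lift_inj ->.
    exact: codom_f.
  have lift0 (a : 'I_N) : val a = 0%N -> val (lift i a) = 0%N.
    by move=> a0; rewrite /= /bump a0 leqNgt i0.
  rewrite (IH c' (fun x => row' i (col' j0 (M x)))) ?mulr0 //.
  - by move=> a b e; apply: ci; rewrite !c'E e.
  - by move=> x y a b hb; rewrite !mxE; apply/hM/cod.
  - by move=> x a b hb a0; rewrite !mxE hM0 ?cod ?lift0.
  move=> g [a ga]; rewrite -[RHS](hg (fun a => lift i (g a))); last first.
    by exists a; rewrite lift0.
  apply: eq_bigr => x _; congr (_ * \det _).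
  by apply/matrixP=> u v; rewrite !mxE c'E.
(* No column is left over: [c] permutes the columns, and its sign is a common factor. *)
have kN : k = N.+1.
  rewrite -[RHS]card_ord -[LHS]card_ord -(card_codom ci).
  by apply: eq_card => j; move/negbFE: (hc j).
subst k; have := hg id (ex_intro _ ord0 erefl).
pose s := perm ci.
under eq_bigr => x _.
  rewrite (_ : (\matrix_(_, _) _) = col_perm s (M x.2)); last first.
    by apply/matrixP=> i j; rewrite !mxE permE.
  rewrite col_permE det_mulmx mulrA det_perm; over.
rewrite -big_distrl /= => /eqP; rewrite mulf_eq0 signr_eq0 orbF => /eqP.
by [].
Qed.

(** * Integer combinations of oriented simplices and their joins *)

Definition osum (V : eqType) k (L : seq (int * ('I_k -> V))) (t : 'I_k -> V) : int :=
  \sum_(x <- L) x.1 * osimp x.2 t.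

Definition joinL m1 m2 k1 k2 (L1 : seq (int * ('I_k1 -> 'I_m1)))
    (L2 : seq (int * ('I_k2 -> 'I_m2))) :
    seq (int * ('I_(k1 + k2) -> 'I_(m1 + m2))) :=
  [seq (x.1 * y.1, fcat (lshift m2 \o x.2) (@rshift m1 m2 \o y.2)) | x <- L1, y <- L2].

Lemma osum_perm (V : eqType) k (L : seq (int * ('I_k -> V))) t (s : 'S_k) :
  osum L (fun i => t (s i)) = (-1) ^+ s * osum L t.
Proof.
by rewrite /osum big_distrr /=; apply: eq_bigr => x _; rewrite osimp_perm mulrCA.
Qed.

Lemma eq_osum (V : eqType) k (L : seq (int * ('I_k -> V))) t t' :
  t =1 t' -> osum L t = osum L t'.
Proof. by move=> e; apply: eq_bigr => x _; rewrite (eq_osimp (F' := x.2) _ e). Qed.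

Lemma osum_joinL m1 m2 k1 k2 (L1 : seq (int * ('I_k1 -> 'I_m1)))
    (L2 : seq (int * ('I_k2 -> 'I_m2))) t s :
  osum (joinL L1 L2) (fcat (lshift m2 \o t) (@rshift m1 m2 \o s))
    = osum L1 t * osum L2 s.
Proof.
rewrite /osum /joinL big_allpairs_dep big_distrlr /=.
apply: eq_bigr => x _; apply: eq_bigr => y _.
rewrite osimp_fcat => [|i j]; last by rewrite eq_sym /= eq_lrshift.
by rewrite !osimp_inj; [rewrite mulrACA|exact: rshift_inj|exact: lshift_inj].
Qed.

Definition closedL (V : finType) n (L : seq (int * ('I_n.+1 -> V))) :=
  forall t : 'I_n -> V, \sum_v osum L (fcons v t) = 0.

(* Summing over [v] replaces the first row of the determinant by ones. *)
Lemma sum_osum_fcons (V : finType) n (L : seq (int * ('I_n.+1 -> V))) (t : 'I_n -> V) :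
  \sum_v osum L (fcons v t) = \sum_(x <- L) x.1 *
    \det (\matrix_(i, j) (if unlift ord0 i is Some i' then (t i' == x.2 j)%:R else 1)).
Proof.
rewrite exchange_big; apply: eq_bigr => x _ /=; rewrite -big_distrr /=; congr (_ * _).
rewrite sum_osimp_fcons (expand_det_row _ ord0); apply: eq_bigr => j _.
rewrite mxE unlift_none mul1r /cofactor add0n; congr (_ * \det _).
by apply/matrixP=> a b; rewrite !mxE liftK.
Qed.

(* [None] encodes the row of ones produced by the boundary operator, [Some None] a
   vertex of the other factor of the join. *)
Definition row_entry (V : eqType) (r : option (option V)) (v : V) : int :=
  match r with None => 1 | Some None => 0 | Some (Some w) => (w == v)%:R end.

(** A second row of ones or a zero row kills every determinant. Otherwise moving row [i0] to the
    front turns the sum into the boundary coefficient at the tuple of the remaining rows. *)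
Lemma sum_det_row_entry (V : finType) n (L : seq (int * ('I_n.+1 -> V)))
    (r : 'I_n.+1 -> option (option V)) i0 :
  closedL L -> r i0 = None ->
  \sum_(x <- L) x.1 * \det (\matrix_(i, j) row_entry (r i) (x.2 j)) = 0.
Proof.
move=> cL ri0.
case: (pickP [pred i | (i != i0) && (r i == None)]) => [i /andP[ii0 /eqP ri]|h1].
  rewrite big1 // => x _; rewrite (determinant_alternate ii0) ?mulr0 // => j.
  by rewrite !mxE ri ri0.
case: (pickP [pred i | r i == Some None]) => [i /eqP ri|h2].
  rewrite big1 // => x _; rewrite (expand_det_row _ i) big1 ?mulr0 // => j _.
  by rewrite mxE ri mul0r.
pose s := tperm ord0 i0.
have [t ht] : exists t : 'I_n -> V, forall i, r (s (lift ord0 i)) = Some (Some (t i)).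
  have h i : exists w, r (s (lift ord0 i)) == Some (Some w).
    have si : s (lift ord0 i) != i0.
      by rewrite -[X in _ != X](tpermL ord0 i0) (inj_eq perm_inj) eq_sym neq_lift.
    move: (h1 (s (lift ord0 i))) (h2 (s (lift ord0 i))) => /=; rewrite si /=.
    by case: (r _) => [[w|]|] //; exists w.
  by exists (fun i => xchoose (h i)) => i; apply/eqP/(xchooseP (h i)).
have := cL t; rewrite sum_osum_fcons => e0.
apply: (@mulfI _ ((-1) ^+ s)); first by rewrite signr_eq0.
rewrite mulr0 -[RHS]e0 big_distrr /=; apply: eq_bigr => x _.
rewrite mulrCA -det_perm -det_mulmx -row_permE; congr (_ * \det _).
apply/matrixP => i j; rewrite !mxE; case: (unliftP ord0 i) => [i'|] ->.
  by rewrite ht.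
by rewrite tpermL ri0.
Qed.

(** The Leibniz rule. The row of ones splits into ones over the columns of the first factor plus
    ones over those of the second; each part vanishes when summed over the list of the factor
    carrying the ones. The dimension is written [n1 + n2.+1] since its successor is convertible to
    [n1.+1 + n2.+1], the length of an [fcat]. *)
Lemma closed_joinL m1 m2 n1 n2 (L1 : seq (int * ('I_n1.+1 -> 'I_m1)))
    (L2 : seq (int * ('I_n2.+1 -> 'I_m2))) :
  closedL L1 -> closedL L2 -> @closedL _ (n1 + n2.+1) (joinL L1 L2).
Proof.
move=> c1 c2 t; rewrite sum_osum_fcons /joinL big_allpairs_dep /=.
pose e (a b : bool) (F : 'I_n1.+1 -> 'I_m1) (G : 'I_n2.+1 -> 'I_m2) :
    'M[int]_((n1 + n2.+1).+1) :=
  \matrix_(i, j) match unlift ord0 i, @split n1.+1 n2.+1 j with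
    | None, inl _ => a%:R | None, inr _ => b%:R
    | Some i', inl j' => (t i' == lshift m2 (F j'))%:R
    | Some i', inr j' => (t i' == rshift m1 (G j'))%:R end.
have esplit F G : \det (\matrix_(i, j) (if unlift ord0 i is Some i'
      then (t i' == @fcat 'I_(m1 + m2) n1.+1 n2.+1 (lshift m2 \o F) (@rshift m1 m2 \o G) j)%:R else 1))
    = \det (e true false F G) + \det (e false true F G).
  rewrite (determinant_multilinear (i0 := ord0) (b := 1) (c := 1)
    (B := e true false F G) (C := e false true F G)) ?mul1r //.
  - apply/matrixP=> i j; rewrite !mxE unlift_none !mul1r.
    by case: (@split n1.+1 n2.+1 j) => ?; rewrite ?addr0 ?add0r.
  - by apply/matrixP=> i j; rewrite !mxE /= liftK /fcat; case: (@split n1.+1 n2.+1 j).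
  - by apply/matrixP=> i j; rewrite !mxE /= liftK /fcat; case: (@split n1.+1 n2.+1 j).
under eq_bigr => x _ do under eq_bigr => y _ do rewrite esplit mulrDr.
under eq_bigr => x _ do rewrite big_split.
rewrite big_split /= [X in X + _]exchange_big /= [X in X + _]big1 ?add0r.
- rewrite big1 // => x _.
  under eq_bigr => y _ do rewrite -mulrA.
  rewrite -big_distrr /= (@sum_det_eq0 _ _ _ _ (@rshift n1.+1 n2.+1)) ?mulr0 //.
  + exact: rshift_inj.
  + move=> F G i j hj; rewrite !mxE; case: (@split_ordP n1.+1 n2.+1 j) hj => b -> //.
    by rewrite codom_f.
  + move=> F i j hj i0; rewrite !mxE (_ : i = ord0) ?unlift_none; last exact: val_inj.
    by case: (@split_ordP n1.+1 n2.+1 j) hj => b -> //; rewrite codom_f.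
  move=> g [i0 gi0].
  pose r i := omap (fun i' => if split (t i') is inr w then Some w else None)
    (unlift ord0 (g i)).
  rewrite -[RHS](sum_det_row_entry (r := r) (i0 := i0) c2); last first.
    by rewrite /r (_ : g i0 = ord0) ?unlift_none //; apply: val_inj.
  apply: eq_bigr => y _; congr (_ * \det _); apply/matrixP=> i j.
  rewrite !mxE (unsplitK (inr j : 'I_n1.+1 + 'I_n2.+1)) /r.
  case: (unlift _ _) => [i'|] //=; case: (split_ordP (t i')) => w -> /=.
    by rewrite eq_lrshift.
  by rewrite (inj_eq (@rshift_inj _ _)).
- move=> y _.
  under eq_bigr => x _ do rewrite mulrAC mulrC.
  rewrite -big_distrr /= (@sum_det_eq0 _ _ _ _ (@lshift n1.+1 n2.+1) (fun F => e true false F _)) ?mulr0 //.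
  + exact: lshift_inj.
  + move=> F G i j hj; rewrite !mxE; case: (@split_ordP n1.+1 n2.+1 j) hj => b -> //.
    by rewrite codom_f.
  + move=> F i j hj i0; rewrite !mxE (_ : i = ord0) ?unlift_none; last exact: val_inj.
    by case: (@split_ordP n1.+1 n2.+1 j) hj => b -> //; rewrite codom_f.
  move=> g [i0 gi0].
  pose r i := omap (fun i' => if split (t i') is inl w then Some w else None)
    (unlift ord0 (g i)).
  rewrite -[RHS](sum_det_row_entry (r := r) (i0 := i0) c1); last first.
    by rewrite /r (_ : g i0 = ord0) ?unlift_none //; apply: val_inj.
  apply: eq_bigr => x _; congr (_ * \det _); apply/matrixP=> i j.
  rewrite !mxE (unsplitK (inl j : 'I_n1.+1 + 'I_n2.+1)) /r.
  case: (unlift _ _) => [i'|] //=; case: (split_ordP (t i')) => w -> /=.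
    by rewrite (inj_eq (@lshift_inj _ _)).
  by rewrite eq_rlshift.
Qed.

(** * Fundamental cycles *)

Definition ceval (V : finType) k (c : chain V k) (t : 'I_k -> V) : int := c (finfun t).

Lemma cevalE (V : finType) k (c : chain V k) (t : {ffun 'I_k -> V}) : c t = ceval c t.
Proof. by rewrite /ceval; congr (c _); apply/ffunP=> i; rewrite ffunE. Qed.

Lemma eq_ceval (V : finType) k (c : chain V k) t t' : t =1 t' -> ceval c t = ceval c t'.
Proof. by move=> e; rewrite /ceval; congr (c _); apply/ffunP=> i; rewrite !ffunE. Qed.

Lemma ceval_perm (V : finType) (K : {set {set V}}) k (c : chain V k) t (s : 'S_k) :
  is_chain K c -> ceval c (fun i => t (s i)) = (-1) ^+ s * ceval c t.
Proof.
case=> h _; rewrite /ceval -h; congr (c _).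
by apply/ffunP=> i; rewrite !ffunE.
Qed.

Lemma ceval_neq0 (V : finType) (K : {set {set V}}) k (c : chain V k) t :
  is_chain K c -> ceval c t != 0 -> injective t /\ [set t i | i : 'I_k] \in K.
Proof.
move=> hc nz; split; last first.
  by have := hc.2 _ nz; congr (_ \in K); apply: eq_imset => i; rewrite ffunE.
move=> i j e; apply/eqP; apply: contraNT nz => ij.
have := ceval_perm t (tperm i j) hc.
rewrite odd_tperm ij expr1 mulN1r (@eq_ceval _ _ c _ t); last first.
  by move=> a; case: tpermP => [->|->|].
by move/eqP; rewrite -addr_eq0 -mulr2n mulrn_eq0.
Qed.

Lemma ceval_boundary (V : finType) k (c : chain V k.+1) t :
  ceval (boundary c) t = \sum_v ceval c (fcons v t).
Proof.
rewrite /ceval ffunE; apply: eq_bigr => v _; congr (c _); apply/ffunP=> i.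
by rewrite !ffunE /fcons; case: unlift => // j; rewrite ffunE.
Qed.

Lemma chain_eq0 (V : finType) k (c : chain V k) : (forall t, ceval c t = 0) -> c = 0.
Proof. by move=> h; apply/ffunP=> t; rewrite cevalE h ffunE. Qed.

(** Applied one dimension above the top, this leaves zero as the only boundary, so homologous top
    cycles are equal. *)
Lemma chain_eq0_card (V : finType) (K : {set {set V}}) k (c : chain V k) :
  (forall s, s \in K -> (#|s| < k)%N) -> is_chain K c -> c = 0.
Proof.
move=> hK hc; apply: chain_eq0 => t; apply/eqP; apply: contraT => nz.
have [ti /hK] := ceval_neq0 hc nz.
by rewrite card_imset // card_ord ltnn.
Qed.

Lemma is_cycleP (V : finType) (K : {set {set V}}) n (c : chain V n.+1) :
  is_cycle K c <-> is_chain K c /\ (forall t, \sum_v ceval c (fcons v t) = 0).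
Proof.
split=> -[hc hb]; split=> //.
  by move=> t; rewrite -ceval_boundary hb /ceval ffunE.
by apply: chain_eq0 => t; rewrite ceval_boundary.
Qed.

Definition chainL (V : finType) k (L : seq (int * ('I_k -> V))) : chain V k :=
  [ffun t : {ffun 'I_k -> V} => osum L t].

Lemma ceval_chainL (V : finType) k (L : seq (int * ('I_k -> V))) t :
  ceval (chainL L) t = osum L t.
Proof. by rewrite /ceval ffunE; apply: eq_osum => i; rewrite ffunE. Qed.

(* The last clause makes [chainL L] a generator of the top-dimensional cycles: a
   cycle [c] is [ceval c F] times [chainL L]. *)
Definition fundamental (V : finType) n (K : {set {set V}})
    (L : seq (int * ('I_n.+1 -> V))) : Prop :=
  [/\ is_complex K, (forall s, s \in K -> (#|s| <= n.+1)%N),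
      all (fun x : int * ('I_n.+1 -> V) => [set x.2 i | i : 'I_n.+1] \in K) L,
      closedL L &
      exists2 F, osum L F = 1 &
        forall c : chain V n.+1, is_cycle K c -> ceval c F = 0 -> c = 0].

Lemma osum_supp (V : finType) k (K : {set {set V}}) (L : seq (int * ('I_k -> V))) t :
  is_complex K -> all (fun x : int * ('I_k -> V) => [set x.2 i | i : 'I_k] \in K) L ->
  osum L t != 0 -> [set t i | i : 'I_k] \in K.
Proof.
move=> [_ hK]; rewrite /osum; elim: L => [|x L IH] /=; first by rewrite big_nil eqxx.
rewrite big_cons => /andP[hx hL]; case: (eqVneq (osimp x.2 t) 0) => [->|nz _].
  by rewrite mulr0 add0r; apply: IH.
apply: hK hx _; apply/subsetP=> _ /imsetP[i _ ->].
apply/imsetP; case: (pickP [pred j | t i == x.2 j]) => [j /eqP e|h]; first by exists j.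
by case/eqP: nz; apply: (@osimp_notin _ _ _ _ i) => j; rewrite (negbT (h j)).
Qed.

Lemma chainL_is_cycle (V : finType) n (K : {set {set V}}) (L : seq (int * ('I_n.+1 -> V))) :
  is_complex K ->
  all (fun x : int * ('I_n.+1 -> V) => [set x.2 i | i : 'I_n.+1] \in K) L ->
  closedL L -> is_cycle K (chainL L).
Proof.
move=> hK hL cL; apply/is_cycleP; split; last first.
  by move=> t; rewrite -[RHS](cL t); apply: eq_bigr => v _; rewrite ceval_chainL.
split=> t => [s|]; last by rewrite cevalE ceval_chainL; apply: osum_supp.
by rewrite !cevalE !ceval_chainL -osum_perm; apply: eq_osum => i; rewrite ffunE.
Qed.

(** The multiple is read off at the test tuple [F], where [chainL L] has coefficient 1: subtracting
    it gives a cycle vanishing at [F], hence zero. *)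
Lemma fundamental_orientation (V : finType) n (K : {set {set V}})
    (L : seq (int * ('I_n.+1 -> V))) :
  fundamental K L -> is_orientation K (chainL L).
Proof.
move=> [hK hcard hL cL [F F1 hF]].
have hz := chainL_is_cycle hK hL cL.
split=> // c hc.
have bd0 (b : chain V n.+2) : is_chain K b -> b = 0 by exact: chain_eq0_card.
have ceval_subz k t : ceval (c - chainL L *~ k) t = ceval c t - osum L t *~ k.
  rewrite -ceval_chainL /ceval ffunE [X in _ + X]ffunE; congr (_ - _).
  case: k => k; first by rewrite -!pmulrn ffunMnE.
  by rewrite !NegzE !mulrNz -!pmulrn ffunE ffunMnE.
exists (ceval c F); split.
  exists 0; last first.
    rewrite (_ : boundary 0 = 0); last first.
      by apply/ffunP=> t; rewrite !ffunE big1 // => v _; rewrite ffunE.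
    apply: hF; last by rewrite ceval_subz F1 -mulrzr mul1r intz subrr.
    apply/is_cycleP; split.
      split=> t => [s|]; rewrite !cevalE !ceval_subz.
        rewrite (@eq_ceval _ _ c _ (fun i => t (s i))); last by move=> i; rewrite ffunE.
        rewrite (@eq_osum _ _ L _ (fun i => t (s i))); last by move=> i; rewrite ffunE.
        by rewrite (ceval_perm _ _ hc.1) osum_perm mulrBr mulrzAr.
      case: (eqVneq (ceval c t) 0) => [->|nz _]; last exact: (ceval_neq0 hc.1 nz).2.
      rewrite sub0r oppr_eq0 => nz; apply: (osum_supp hK hL).
      by apply: contraNneq nz => ->; rewrite mul0rz.
    move=> t; under eq_bigr do rewrite ceval_subz.
    rewrite big_split /= sumrN -mulrz_suml cL mul0rz subr0.
    exact: ((is_cycleP _ _).1 hc).2.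
  split=> [t s|t]; first by rewrite !ffunE mulr0.
  by rewrite ffunE eqxx.
move=> k [b hb]; rewrite (bd0 _ hb) => e.
have : ceval (c - chainL L *~ k) F = 0.
  by rewrite e ceval_boundary big1 // => v _; rewrite /ceval ffunE.
by rewrite ceval_subz F1 -mulrzr mul1r intz => /eqP; rewrite subr_eq0 => /eqP.
Qed.

(** * Joins *)

Definition join m1 m2 (K1 : {set {set 'I_m1}}) (K2 : {set {set 'I_m2}}) :
    {set {set 'I_(m1 + m2)}} :=
  [set s : {set 'I_(m1 + m2)} | (lshift m2 @^-1: s \in K1) && (@rshift m1 m2 @^-1: s \in K2)].

Lemma joinP m1 m2 (K1 : {set {set 'I_m1}}) (K2 : {set {set 'I_m2}})
    (s : {set 'I_(m1 + m2)}) :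
  reflect (lshift m2 @^-1: s \in K1 /\ @rshift m1 m2 @^-1: s \in K2) (s \in join K1 K2).
Proof. by rewrite inE; apply: andP. Qed.

Lemma join_complex m1 m2 (K1 : {set {set 'I_m1}}) (K2 : {set {set 'I_m2}}) :
  is_complex K1 -> is_complex K2 -> is_complex (join K1 K2).
Proof.
move=> [h1 k1] [h2 k2]; split; first by rewrite inE !preimset0 h1.
move=> s t /joinP[s1 s2] ts; apply/joinP.
by split; [apply: k1 s1 _|apply: k2 s2 _]; apply: preimsetS.
Qed.

Lemma card_shift_preim m1 m2 (s : {set 'I_(m1 + m2)}) :
  #|s| = (#|lshift m2 @^-1: s| + #|@rshift m1 m2 @^-1: s|)%N.
Proof.
rewrite -(card_imset _ (@lshift_inj m1 m2)) -(card_imset _ (@rshift_inj m1 m2)).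
have disj : [set lshift m2 x | x in lshift m2 @^-1: s]
    :&: [set @rshift m1 m2 x | x in @rshift m1 m2 @^-1: s] = set0.
  apply/setP=> i; rewrite !inE; apply/negP=> /andP[/imsetP[a _ ->] /imsetP[b _ /eqP]].
  by rewrite eq_lrshift.
rewrite -cardsUI disj cards0 addn0; apply: eq_card => i; rewrite !inE.
apply/idP/orP; last by case=> /imsetP[j]; rewrite inE => h ->.
case: (split_ordP i) => j -> h; [left|right]; by rewrite imset_f // inE.
Qed.

Lemma fcat_preiml m1 m2 k1 k2 (t : 'I_k1 -> 'I_m1) (u : 'I_k2 -> 'I_m2) :
  lshift m2 @^-1: [set fcat (lshift m2 \o t) (@rshift m1 m2 \o u) i | i : 'I_(k1 + k2)]
    = [set t i | i : 'I_k1].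
Proof.
apply/setP=> v; rewrite !inE; apply/imsetP/imsetP => -[i _].
  case: (split_ordP i) => j ->; rewrite ?fcatl ?fcatr /= => /eqP.
    by rewrite (inj_eq (@lshift_inj _ _)) => /eqP->; exists j.
  by rewrite eq_lrshift.
by move=> ->; exists (lshift k2 i); rewrite ?fcatl.
Qed.

Lemma fcat_preimr m1 m2 k1 k2 (t : 'I_k1 -> 'I_m1) (u : 'I_k2 -> 'I_m2) :
  @rshift m1 m2 @^-1: [set fcat (lshift m2 \o t) (@rshift m1 m2 \o u) i | i : 'I_(k1 + k2)]
    = [set u i | i : 'I_k2].
Proof.
apply/setP=> v; rewrite !inE; apply/imsetP/imsetP => -[i _].
  case: (split_ordP i) => j ->; rewrite ?fcatl ?fcatr /= => /eqP.
    by rewrite eq_rlshift.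
  by rewrite (inj_eq (@rshift_inj _ _)) => /eqP->; exists j.
by move=> ->; exists (rshift k1 i); rewrite ?fcatr.
Qed.

(** The parity comes from a determinant: evaluating [osimp id] at a permutation gives its sign, and
    for a block permutation this value factors over the blocks. *)
Lemma fcat_perm (V : eqType) k1 k2 (s1 : 'S_k1) (s2 : 'S_k2) :
  exists2 p : 'S_(k1 + k2), p = s1 (+) s2 :> bool &
    forall (t : 'I_k1 -> V) (u : 'I_k2 -> V),
      fcat t u \o p =1 fcat (t \o s1) (u \o s2).
Proof.
pose h : 'I_(k1 + k2) -> 'I_(k1 + k2) := fcat (lshift k2 \o s1) (@rshift k1 k2 \o s2).
have hi : injective h.
  move=> i j; rewrite /h; case: (split_ordP i) => a ->; case: (split_ordP j) => b ->;
    rewrite ?fcatl ?fcatr /= => /eqP; rewrite ?eq_lrshift ?eq_rlshift //.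
    by rewrite (inj_eq (@lshift_inj _ _)) (inj_eq perm_inj) => /eqP->.
  by rewrite (inj_eq (@rshift_inj _ _)) (inj_eq perm_inj) => /eqP->.
exists (perm hi); last first.
  move=> t u i; rewrite /= permE /h; case: (split_ordP i) => a ->.
    by rewrite !fcatl.
  by rewrite !fcatr.
apply: (@signr_inj int); rewrite signr_addb.
have idE : fcat (lshift k2) (@rshift k1 k2) =1 id.
  by move=> i; case: (split_ordP i) => a ->; rewrite ?fcatl ?fcatr.
have := osimp_perm id id (perm hi); rewrite osimp_self // mulr1 => /= <-.
rewrite -(eq_osimp idE (frefl _)) (@eq_osimp _ _ _ _ _ h (frefl _)); last first.
  by move=> i; rewrite permE.
rewrite osimp_fcat => [|i j]; last by rewrite eq_rlshift.
rewrite !osimp_perm (osimp_self (@lshift_inj _ _)) (osimp_self (@rshift_inj _ _)).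
by rewrite !mulr1.
Qed.

(** The two bounds add up to the number of vertices of [t], so both are equalities and the vertices
    can be listed factor by factor. *)
Lemma fcat_sorted m1 m2 k1 k2 (t : 'I_(k1 + k2) -> 'I_(m1 + m2)) :
  injective t ->
  (#|lshift m2 @^-1: [set t i | i : 'I_(k1 + k2)]| <= k1)%N ->
  (#|@rshift m1 m2 @^-1: [set t i | i : 'I_(k1 + k2)]| <= k2)%N ->
  exists (s : 'S_(k1 + k2)) t1 t2,
    (fun i => t (s i)) =1 fcat (lshift m2 \o t1) (@rshift m1 m2 \o t2).
Proof.
move=> ti c1 c2.
set A1 := lshift m2 @^-1: _ in c1; set A2 := _ @^-1: _ in c2.
have card12 : (#|A1| + #|A2|)%N = (k1 + k2)%N.
  by rewrite -card_shift_preim card_imset // card_ord.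
have e1 : k1 = #|A1| by lia.
have e2 : k2 = #|A2| by lia.
pose t1 (i : 'I_k1) : 'I_m1 := enum_val (cast_ord e1 i).
pose t2 (i : 'I_k2) : 'I_m2 := enum_val (cast_ord e2 i).
pose T := fcat (lshift m2 \o t1) (@rshift m1 m2 \o t2).
have hT i : exists j, t j == T i.
  have : T i \in [set t i | i : 'I_(k1 + k2)].
    rewrite /T; case: (split_ordP i) => a ->; rewrite ?fcatl ?fcatr /=.
      by have := enum_valP (cast_ord e1 a); rewrite inE.
    by have := enum_valP (cast_ord e2 a); rewrite inE.
  by move=> /imsetP[j _ ->]; exists j.
pose s i := xchoose (hT i).
have sE i : t (s i) = T i by apply/eqP/(xchooseP (hT i)).
have Ti : injective T.
  move=> i j; rewrite /T; case: (split_ordP i) => a ->; case: (split_ordP j) => b ->;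
    rewrite ?fcatl ?fcatr /= => /eqP; rewrite ?eq_lrshift ?eq_rlshift //.
    by rewrite (inj_eq (@lshift_inj _ _)) => /eqP /enum_val_inj /cast_ord_inj ->.
  by rewrite (inj_eq (@rshift_inj _ _)) => /eqP /enum_val_inj /cast_ord_inj ->.
have si : injective s by move=> i j e; apply: Ti; rewrite -!sE e.
by exists (perm si), t1, t2 => i; rewrite permE sE.
Qed.

Section JoinFundamental.
Variables (m1 m2 n1 n2 : nat) (K1 : {set {set 'I_m1}}) (K2 : {set {set 'I_m2}}).
Hypothesis card1 : forall s, s \in K1 -> (#|s| <= n1.+1)%N.
Hypothesis card2 : forall s, s \in K2 -> (#|s| <= n2.+1)%N.
Variable c : chain 'I_(m1 + m2) (n1 + n2.+1).+1.
Hypothesis cyc : is_cycle (join K1 K2) c.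

Let jn (t : 'I_n1.+1 -> 'I_m1) (u : 'I_n2.+1 -> 'I_m2) :
    'I_(n1 + n2.+1).+1 -> 'I_(m1 + m2) :=
  @fcat _ n1.+1 n2.+1 (lshift m2 \o t) (@rshift m1 m2 \o u).

(** Freezing the tuple of one factor turns a chain on the join into a chain on the other factor;
    this reduces cycles on the join to cycles on the factors. *)
Let slicel u : chain 'I_m1 n1.+1 :=
  [ffun t : {ffun 'I_n1.+1 -> 'I_m1} => ceval c (jn t u)].
Let slicer t : chain 'I_m2 n2.+1 :=
  [ffun u : {ffun 'I_n2.+1 -> 'I_m2} => ceval c (jn t u)].

Let eq_jn t t' u u' : t =1 t' -> u =1 u' -> jn t u =1 jn t' u'.
Proof.
move=> et eu i; rewrite /jn; case: (@split_ordP n1.+1 n2.+1 i) => a ->.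
  by rewrite !fcatl /= et.
by rewrite !fcatr /= eu.
Qed.

Let ceval_slicel u t : ceval (slicel u) t = ceval c (jn t u).
Proof. by rewrite /ceval ffunE; apply: eq_ceval; apply: eq_jn => // i; rewrite ffunE. Qed.

Let ceval_slicer u t : ceval (slicer t) u = ceval c (jn t u).
Proof. by rewrite /ceval ffunE; apply: eq_ceval; apply: eq_jn => // i; rewrite ffunE. Qed.

(** A dimension count: [h] selects [k] positions of [T] filled with vertices of the first factor,
    too many for a simplex of [K1]. *)
Let few_left k (u : 'I_k -> 'I_m1) (h : 'I_k -> 'I_(n1 + n2.+1).+1) T :
  injective h -> T \o h =1 lshift m2 \o u -> (n1.+1 < k)%N -> ceval c T = 0.
Proof.
move=> hi e lt; apply/eqP; apply: contraLR lt => nz; rewrite -leqNgt.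
have [Ti /joinP[hK _]] := ceval_neq0 cyc.1 nz.
have ui : injective u.
  move=> i j eu; apply: hi; apply: Ti; apply: etrans (etrans (e i) _) (esym (e j)).
  by rewrite /= eu.
rewrite -(card_ord k) -(card_imset _ ui); apply: leq_trans (card1 hK).
apply/subset_leq_card/subsetP => _ /imsetP[i _ ->]; rewrite inE.
by have := e i; rewrite /= => <-; apply: imset_f.
Qed.

Let few_right k (u : 'I_k -> 'I_m2) (h : 'I_k -> 'I_(n1 + n2.+1).+1) T :
  injective h -> T \o h =1 @rshift m1 m2 \o u -> (n2.+1 < k)%N -> ceval c T = 0.
Proof.
move=> hi e lt; apply/eqP; apply: contraLR lt => nz; rewrite -leqNgt.
have [Ti /joinP[_ hK]] := ceval_neq0 cyc.1 nz.
have ui : injective u.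
  move=> i j eu; apply: hi; apply: Ti; apply: etrans (etrans (e i) _) (esym (e j)).
  by rewrite /= eu.
rewrite -(card_ord k) -(card_imset _ ui); apply: leq_trans (card2 hK).
apply/subset_leq_card/subsetP => _ /imsetP[i _ ->]; rewrite inE.
by have := e i; rewrite /= => <-; apply: imset_f.
Qed.

Let fcons_inj (V : eqType) k (v : V) (t : 'I_k -> V) :
  injective t -> (forall i, v != t i) -> injective (fcons v t).
Proof.
move=> ti vt i j; case: (unliftP ord0 i) => [i'|] ->; case: (unliftP ord0 j) => [j'|] ->;
  rewrite ?fcons0 ?fconsS //.
- by move=> /ti ->.
- by move=> e; have := vt i'; rewrite e eqxx.
- by move=> e; have := vt j'; rewrite -e eqxx.
Qed.

Let sum_shift (f : 'I_(m1 + m2) -> int) :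
  \sum_v f v = \sum_v f (lshift m2 v) + \sum_v f (@rshift m1 m2 v).
Proof. exact: big_split_ord. Qed.

(** In the boundary of [c] at [t] followed by [u], inserting a vertex of the second factor gives
    [n2 + 2] vertices there and contributes zero; the insertions from the first factor form the
    boundary of the slice. *)
Lemma slicel_cycle u : is_cycle K1 (slicel u).
Proof.
apply/is_cycleP; split; [split=> [t s|t]|move=> t].
- rewrite !cevalE !ceval_slicel; have [p ps pE] := @fcat_perm 'I_(m1 + m2) n1.+1 n2.+1 s 1.
  rewrite odd_perm1 addbF in ps; rewrite -ps -(ceval_perm _ _ cyc.1); apply: eq_ceval => i.
  rewrite [RHS](pE (lshift m2 \o t) (@rshift m1 m2 \o u)); apply: eq_jn => j;
    by rewrite /= ?perm1 ?ffunE.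
- rewrite cevalE ceval_slicel => /(ceval_neq0 cyc.1)[_ /joinP[hK _]].
  by rewrite (@fcat_preiml _ _ n1.+1 n2.+1) in hK.
under eq_bigr do rewrite ceval_slicel.
pose T : 'I_(n1 + n2.+1) -> 'I_(m1 + m2) := fcat (lshift m2 \o t) (@rshift m1 m2 \o u).
have := ((is_cycleP _ _).1 cyc).2 T; rewrite sum_shift [X in _ + X]big1 ?addr0.
  move=> e; rewrite -[RHS]e; apply: eq_bigr => v _; apply: eq_ceval => i.
  case: (unliftP ord0 i) => [i'|] ->; rewrite ?fcons0 ?fconsS.
    rewrite /T; case: (split_ordP i') => a ->; rewrite ?fcatl ?fcatr /=.
      rewrite (_ : lift ord0 _ = @lshift n1.+1 n2.+1 (lift ord0 a)); last exact: val_inj.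
      by rewrite /jn fcatl /= fconsS.
    rewrite (_ : lift ord0 _ = @rshift n1.+1 n2.+1 a); last exact: val_inj.
    by rewrite /jn fcatr.
  rewrite (_ : ord0 = @lshift n1.+1 n2.+1 ord0); last exact: val_inj.
  by rewrite /jn fcatl /= fcons0.
move=> v _.
apply: (@few_right _ (fcons v u) (fcons ord0 (lift ord0 \o @rshift n1 n2.+1))) => //.
  apply: fcons_inj => [|i]; last exact: neq_lift.
  by apply: inj_comp; [exact: lift_inj|exact: rshift_inj].
move=> i /=; case: (unliftP ord0 i) => [i'|] ->; rewrite ?fcons0 ?fconsS //=.
by rewrite /T fcatr.
Qed.

(* The summand at [v] is the value of [c] at [v] followed by the remaining
   vertices, up to exchanging [v] with the first vertex of [t]. *)
Lemma slicer_cycle t : is_cycle K2 (slicer t).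
Proof.
apply/is_cycleP; split; [split=> [u s|u]|move=> u].
- rewrite !cevalE !ceval_slicer; have [p ps pE] := @fcat_perm 'I_(m1 + m2) n1.+1 n2.+1 1 s.
  rewrite odd_perm1 addFb in ps; rewrite -ps -(ceval_perm _ _ cyc.1); apply: eq_ceval => i.
  rewrite [RHS](pE (lshift m2 \o t) (@rshift m1 m2 \o u)); apply: eq_jn => j;
    by rewrite /= ?perm1 ?ffunE.
- rewrite cevalE ceval_slicer => /(ceval_neq0 cyc.1)[_ /joinP[_ hK]].
  by rewrite (@fcat_preimr _ _ n1.+1 n2.+1) in hK.
under eq_bigr do rewrite ceval_slicer.
(* The first vertex of [t] is parked at the head of the second block, so a vertex inserted in front
   reaches its place by one transposition. *)
pose T : 'I_(n1 + n2.+1) -> 'I_(m1 + m2) :=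
  fcat (lshift m2 \o (fun i => t (lift ord0 i)))
       (fcons (lshift m2 (t ord0)) (@rshift m1 m2 \o u)).
have := ((is_cycleP _ _).1 cyc).2 T; rewrite sum_shift [X in X + _]big1 ?add0r.
  pose p : 'S_((n1 + n2.+1).+1) := tperm ord0 (@rshift n1.+1 n2.+1 ord0).
  move=> e; apply: (@mulfI _ ((-1) ^+ p)); first by rewrite signr_eq0.
  rewrite mulr0 -[RHS]e big_distrr; apply: eq_bigr => v _ /=.
  rewrite -(ceval_perm _ _ cyc.1); apply: eq_ceval => i.
  have o0 : ord0 = @lshift n1.+1 n2.+1 ord0 by apply: val_inj.
  have l0 : lift ord0 (@rshift n1 n2.+1 ord0) = @rshift n1.+1 n2.+1 ord0.
    exact: val_inj.
  rewrite /p; case: tpermP => [->|->|]; rewrite ?fcons0.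
  - by rewrite /jn fcatr /= fcons0.
  - by rewrite -l0 fconsS /T fcatr fcons0 o0 /jn fcatl.
  case: (unliftP ord0 i) => [i'|] -> // _; rewrite fconsS /T.
  case: (split_ordP i') => a ->; rewrite ?fcatl ?fcatr /=.
    rewrite (_ : lift ord0 _ = @lshift n1.+1 n2.+1 (lift ord0 a)); last exact: val_inj.
    by rewrite /jn fcatl.
  rewrite (_ : lift ord0 _ = @rshift n1.+1 n2.+1 a); last exact: val_inj.
  rewrite /jn fcatr /=.
  by case: (unliftP ord0 a) => [a'|] -> // _; rewrite !fconsS.
move=> v _.
pose h := fcons (lift ord0 (@rshift n1 n2.+1 ord0)) (lift ord0 \o lshift n2.+1).
apply: (@few_left _ (fcons v t) (fcons ord0 h)) => //.
  apply: fcons_inj => [|i].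
    apply: fcons_inj => [|i]; last by rewrite /= (inj_eq lift_inj) eq_rlshift.
    by apply: inj_comp; [exact: lift_inj|exact: lshift_inj].
  by rewrite /h /fcons; case: unlift => [i'|]; apply: neq_lift.
move=> i /=; case: (unliftP ord0 i) => [i'|] ->; rewrite ?fcons0 ?fconsS //=.
rewrite /h; case: (unliftP ord0 i') => [i''|] ->; rewrite ?fcons0 ?fconsS //=.
  by rewrite /T fcatl.
by rewrite /T fcatr fcons0.
Qed.

(** Vanishing spreads in two moves: from [(F1, F2)] to [(F1, u)] inside the slice at [F1], then to
    [(t, u)] inside the slice at [u]. *)
Lemma join_cycle_eq0 F1 F2 :
  (forall b : chain 'I_m1 n1.+1, is_cycle K1 b -> ceval b F1 = 0 -> b = 0) ->
  (forall b : chain 'I_m2 n2.+1, is_cycle K2 b -> ceval b F2 = 0 -> b = 0) ->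
  ceval c (jn F1 F2) = 0 -> c = 0.
Proof.
move=> h1 h2 c0; apply: chain_eq0 => T; apply/eqP; apply: contraT => nz.
have [Ti /joinP[k1 k2]] := ceval_neq0 cyc.1 nz.
have [s [t [u e]]] := @fcat_sorted _ _ n1.+1 n2.+1 _ Ti (card1 k1) (card2 k2).
have: ceval c (jn t u) != 0.
  by rewrite -(eq_ceval _ e) (ceval_perm _ _ cyc.1) mulf_neq0 ?signr_eq0.
rewrite -ceval_slicel (h1 _ (slicel_cycle u)) ?[ceval 0 _]ffunE ?eqxx //.
rewrite ceval_slicel -ceval_slicer (h2 _ (slicer_cycle F1)) ?[ceval 0 _]ffunE //.
by rewrite ceval_slicer.
Qed.

End JoinFundamental.

Lemma join_fundamental m1 m2 n1 n2 (K1 : {set {set 'I_m1}}) (K2 : {set {set 'I_m2}})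
    (L1 : seq (int * ('I_n1.+1 -> 'I_m1))) (L2 : seq (int * ('I_n2.+1 -> 'I_m2))) :
  fundamental K1 L1 -> fundamental K2 L2 ->
  @fundamental _ (n1 + n2.+1) (join K1 K2) (joinL L1 L2).
Proof.
move=> [c1 d1 s1 cl1 [F1 e1 h1]] [c2 d2 s2 cl2 [F2 e2 h2]]; split.
- exact: join_complex.
- move=> s /joinP[/d1 k1 /d2 k2]; rewrite card_shift_preim -addSn.
  exact: leq_add.
- rewrite /joinL; elim: L1 s1 {cl1 e1} => //= x L1 IH /andP[sx sL1].
  rewrite all_cat IH // andbT all_map; apply: sub_all s2 => y /= sy.
  by apply/joinP; rewrite (@fcat_preiml _ _ n1.+1 n2.+1) (@fcat_preimr _ _ n1.+1 n2.+1).
- exact: closed_joinL.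
exists (@fcat _ n1.+1 n2.+1 (lshift m2 \o F1) (@rshift m1 m2 \o F2)).
  by rewrite (@osum_joinL _ _ n1.+1 n2.+1) e1 e2.
by move=> c hc c0; apply: (@join_cycle_eq0 _ _ _ _ _ _ d1 d2 c hc F1 F2).
Qed.

(** * Simplex boundaries and polygons *)

Lemma std_sphereP n (s : {set 'I_n.+2}) :
  reflect (exists v, v \notin s) (s \in std_sphere n).
Proof.
rewrite inE properE subsetT /=; apply: (iffP subsetPn) => -[v].
  by move=> _ ?; exists v.
by exists v; rewrite ?inE.
Qed.

Lemma card_std_sphere n (s : {set 'I_n.+2}) : (s \in std_sphere n) = (#|s| <= n.+1)%N.
Proof. by rewrite inE properEcard subsetT cardsT card_ord ltnS. Qed.

Lemma std_sphere_complex n : is_complex (std_sphere n).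
Proof.
split; first by apply/std_sphereP; exists ord0; rewrite inE.
move=> s t /std_sphereP[v vs] ts; apply/std_sphereP; exists v.
by apply: contra vs; apply: (subsetP ts).
Qed.

Definition std_sphereL n : seq (int * ('I_n.+1 -> 'I_n.+2)) :=
  [seq ((-1) ^+ (j : 'I_n.+2), lift j) | j <- enum 'I_n.+2].

Lemma osum_std_sphereL n t :
  osum (std_sphereL n) t = \sum_v osimp id (fcons v t).
Proof. by rewrite sum_osimp_fcons /osum /std_sphereL big_map big_enum. Qed.

(** The boundary of a boundary is zero: the double sum over two inserted vertices changes sign when
    they are exchanged. *)
Lemma closed_std_sphereL n : closedL (std_sphereL n).
Proof.
move=> t; under eq_bigr do rewrite osum_std_sphereL.
set S := (X in X = 0); have : S = - S; last first.
  by move/eqP; rewrite -addr_eq0 -mulr2n mulrn_eq0 => /eqP.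
rewrite {1}/S exchange_big /= /S -sumrN; apply: eq_bigr => v _.
rewrite -sumrN; apply: eq_bigr => w _.
pose s : 'S_n.+2 := tperm ord0 (lift ord0 ord0).
rewrite -mulN1r -[-1 in RHS](_ : (-1) ^+ s = -1); last by rewrite odd_tperm neq_lift.
rewrite -osimp_perm; apply: eq_osimp => // i; rewrite /s.
case: tpermP => [->|->|]; rewrite ?fconsS ?fcons0 //.
case: (unliftP ord0 i) => [i'|] -> // _; rewrite !fconsS.
by case: (unliftP ord0 i') => [j|] -> // _; rewrite !fconsS.
Qed.

Lemma osum_std_sphere1 n : osum (std_sphereL n) (lift ord0) = 1.
Proof.
rewrite osum_std_sphereL (bigD1 ord0) //= big1 ?addr0 => [|v].
  rewrite -[RHS](@osimp_self 'I_n.+2 _ id) //; apply: eq_osimp => // i.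
  by case: (unliftP ord0 i) => [j|] ->; rewrite ?fcons0 ?fconsS.
rewrite osimp_tr; case: (unliftP ord0 v) => [j|] -> // _.
by apply: (@osimp_rep _ _ _ _ ord0 (lift ord0 j)); rewrite ?fcons0 ?fconsS.
Qed.

(** The test facet is the one opposite to vertex 0. A facet through 0 is settled by the boundary at
    its face [t] without 0: the other simplices over [t] avoid 0, hence are the test facet up to
    order. *)
Lemma std_sphere_fundamental n : fundamental (std_sphere n) (std_sphereL n).
Proof.
have hK (t : 'I_n.+1 -> 'I_n.+2) : [set t i | i : 'I_n.+1] \in std_sphere n.
  by rewrite card_std_sphere (leq_trans (leq_imset_card _ _)) // card_ord.
split.
- exact: std_sphere_complex.
- by move=> s; rewrite card_std_sphere.
- by elim: (std_sphereL n) => //= x L ->; rewrite hK.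
- exact: closed_std_sphereL.
exists (lift ord0); first exact: osum_std_sphere1.
move=> c hc c0.
have no0 T : injective T -> (forall i, T i != ord0) -> ceval c T = 0.
  move=> Ti T0; have [t tE] : exists t, forall i, T i = lift ord0 (t i).
    have h i : exists j, T i == lift ord0 j.
      by move: (T0 i); case: (unliftP ord0 (T i)) => [j|] -> // _; exists j.
    by exists (fun i => xchoose (h i)) => i; apply/eqP/(xchooseP (h i)).
  have ti : injective t by move=> i j e; apply: Ti; rewrite !tE e.
  rewrite (@eq_ceval _ _ c _ (fun i => lift ord0 (perm ti i))); last by move=> i; rewrite permE.
  by rewrite (ceval_perm _ _ hc.1) c0 mulr0.
apply: chain_eq0 => T; apply/eqP; apply: contraT => nz.
have [Ti _] := ceval_neq0 hc.1 nz.
case: (pickP [pred i | T i == ord0]) => [i0 /= /eqP e0|h]; last first.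
  by case/eqP: nz; apply: no0 => // i; rewrite (negbT (h i)).
pose s : 'S_n.+1 := tperm ord0 i0.
pose t i := T (s (lift ord0 i)).
have TE : T \o s =1 fcons ord0 t.
  move=> i; case: (unliftP ord0 i) => [j|] ->; rewrite ?fcons0 ?fconsS //=.
  by rewrite /s tpermL.
have ft : injective (fcons ord0 t).
  by move=> i j; rewrite -!TE /= => /Ti /perm_inj.
have := ((is_cycleP _ _).1 hc).2 t; rewrite (bigD1 ord0) //= big1 ?addr0.
  by rewrite -(eq_ceval _ TE) (ceval_perm _ _ hc.1) => /eqP; rewrite mulf_eq0 signr_eq0 (negPf nz).
have t0 i : t i != ord0.
  rewrite /t -e0 (inj_eq Ti) -[X in _ != X](tpermL ord0 i0) (inj_eq perm_inj).
  by rewrite eq_sym neq_lift.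
move=> v v0; apply/eqP; apply: contraT => nzv.
have [vi _] := ceval_neq0 hc.1 nzv.
case/eqP: nzv; apply: no0 => // i.
by case: (unliftP ord0 i) => [j|] ->; rewrite ?fcons0 ?fconsS.
Qed.

Definition polygon m : {set {set 'I_m}} :=
  [set s : {set 'I_m} | (s == set0) || [exists i, s \subset [set i; ordS i]]].

Definition arrow (V : Type) (x y : V) : 'I_2 -> V := fcons x (fun _ => y).

Definition polygonL m : seq (int * ('I_2 -> 'I_m)) :=
  [seq (1, arrow i (ordS i)) | i <- enum 'I_m].

Lemma polygon_complex m : is_complex (polygon m).
Proof.
split; first by rewrite inE eqxx.
move=> s t; rewrite !inE => /orP[/eqP->|/existsP[i si] ts].
  by rewrite subset0 => ->.
by apply/orP; right; apply/existsP; exists i; apply: subset_trans si.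
Qed.

Lemma arrowE (V : Type) (t : 'I_2 -> V) : t =1 arrow (t ord0) (t ord_max).
Proof.
move=> i; rewrite /arrow; case: (unliftP ord0 i) => [j|] ->; rewrite ?fcons0 ?fconsS //.
by congr t; apply: val_inj; rewrite /= (ord1 j).
Qed.

Lemma arrow0 (V : Type) (x y : V) : arrow x y ord0 = x.
Proof. by rewrite /arrow fcons0. Qed.

Lemma arrow1 (V : Type) (x y : V) : arrow x y ord_max = y.
Proof. by rewrite /arrow (_ : ord_max = lift ord0 ord0) ?fconsS //; apply: val_inj. Qed.

Lemma arrow_image (V : finType) (x y : V) : [set arrow x y i | i : 'I_2] = [set x; y].
Proof.
apply/setP=> v; rewrite !inE; apply/imsetP/orP => [[i _ ->]|[/eqP->|/eqP->]].
- rewrite /arrow; case: (unliftP ord0 i) => [j|] ->; rewrite ?fcons0 ?fconsS eqxx; [by right|by left].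
- by exists ord0; rewrite ?inE // /arrow fcons0.
by exists ord_max; rewrite ?inE // /arrow (_ : ord_max = lift ord0 ord0) ?fconsS //; apply: val_inj.
Qed.

Section Polygon.
Variable p : nat.
Notation m := p.+3.
Implicit Types i j : 'I_m.

Lemma ordS_neq i : ordS i != i.
Proof.
apply/eqP => /(congr1 val) /=; have := ltn_ord i.
have [e|h] := eqVneq (i.+1 : nat) m; first by rewrite e modnn; lia.
by move=> ?; rewrite modn_small; lia.
Qed.

(** This is where three vertices matter: in a 2-gon the two arrows would span the same edge and
    cancel. *)
Lemma ordSS_neq i : ordS (ordS i) != i.
Proof.
apply/eqP => /(congr1 val) /=; have := ltn_ord i.
have [e|h] := eqVneq (i.+1 : nat) m; first by rewrite e modnn modn_small //; lia.
move=> ?; rewrite (@modn_small i.+1); last by lia.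
have [e'|h'] := eqVneq (i.+2 : nat) m; first by rewrite e' modnn; lia.
by rewrite modn_small; lia.
Qed.

Lemma polygon_edge (x y : 'I_m) : x != y -> [set x; y] \in polygon m ->
  y = ordS x \/ x = ordS y.
Proof.
move=> xy; rewrite inE => /orP[/eqP h|/existsP[i /subsetP h]].
  by have := set21 x y; rewrite h inE.
have := h x; have := h y; rewrite !inE !eqxx /= orbT => /(_ isT) /orP[]/eqP ey /(_ isT)
  /orP[]/eqP ex; subst; rewrite ?eqxx in xy => //; [by right|by left].
Qed.

Lemma closed_polygonL : closedL (polygonL m).
Proof.
move=> t; rewrite exchange_big /= /polygonL big_map big_enum /=.
have E i : \sum_v 1 * osimp (arrow i (ordS i)) (fcons v t)
    = osimp (fun=> ordS i) t - osimp (fun=> i) t.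
  under eq_bigr do rewrite mul1r.
  rewrite sum_osimp_fcons !big_ord_recl big_ord0 addr0 /= expr0 mul1r expr1 mulN1r.
  congr (_ - _); apply: eq_osimp => // a; rewrite /arrow ?fconsS //.
  rewrite [lift (lift _ _) _](_ : _ = ord0) ?fcons0 //.
  by apply: val_inj; case: a => [[]].
under eq_bigr do rewrite E.
rewrite big_split /= sumrN.
rewrite [X in _ - X](reindex_inj (@ordS_inj m)) /=.
by rewrite subrr.
Qed.

(** Closedness at [ordS i] equates the coefficients of the two edges meeting there, so a cycle is
    constant around the polygon. *)
Lemma polygon_fundamental : fundamental (polygon m) (polygonL m).
Proof.
split.
- exact: polygon_complex.
- move=> s; rewrite inE => /orP[/eqP->|/existsP[i si]]; first by rewrite cards0.
  by rewrite (leq_trans (subset_leq_card si)) // cards2; case: eqP.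
- rewrite /polygonL all_map; apply/allP => i _ /=.
  by rewrite arrow_image inE; apply/orP; right; apply/existsP; exists i.
- exact: closed_polygonL.
have arrow_inj (x y : 'I_m) : x != y -> injective (arrow x y).
  move=> xy a b; rewrite /arrow.
  case: (unliftP ord0 a) => [a'|] ->; case: (unliftP ord0 b) => [b'|] ->;
    rewrite ?fcons0 ?fconsS //.
  - by rewrite (ord1 a') (ord1 b').
  - by move=> e; rewrite e eqxx in xy.
  - by move=> e; rewrite e eqxx in xy.
exists (arrow ord0 (ordS ord0)).
  rewrite /osum /polygonL big_map big_enum /= (bigD1 ord0) //= mul1r big1 => [|i i0].
    by rewrite osimp_self ?addr0 //; apply: arrow_inj; rewrite eq_sym ordS_neq.
  rewrite mul1r; apply/eqP; apply: contraT => nz.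
  have h a : exists b, arrow ord0 (ordS ord0) a == arrow i (ordS i) b.
    case: (pickP [pred b | arrow ord0 (ordS ord0) a == arrow i (ordS i) b]) => [b hb|h].
      by exists b.
    by case/eqP: nz; apply: (@osimp_notin _ _ _ _ a) => b; rewrite (negbT (h b)).
  have sub x : x \in [set ord0; ordS ord0] -> x \in [set i; ordS i].
    rewrite -!arrow_image => /imsetP[a _ ->]; have [b /eqP ->] := h a.
    exact: imset_f.
  have := sub ord0; rewrite !inE eqxx /= eq_sym (negPf i0) /= => /(_ isT) /eqP e0.
  have := sub (ordS ord0); rewrite !inE eqxx orbT (inj_eq (@ordS_inj m)) => /(_ isT).
  by rewrite (eq_sym ord0 i) (negPf i0) orbF e0 (negPf (ordSS_neq i)).
move=> c hc c0.
have step i : ceval c (arrow (ordS i) (ordS (ordS i))) = ceval c (arrow i (ordS i)).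
  have := ((is_cycleP _ _).1 hc).2 (fun _ => ordS i).
  rewrite (bigD1 i) //= (bigD1 (ordS (ordS i))) ?ordSS_neq //= big1 ?addr0.
    move=> /eqP; rewrite addr_eq0 => /eqP->; pose s : 'S_2 := tperm ord0 (lift ord0 ord0).
    rewrite -mulN1r (_ : -1 = (-1) ^+ s); last by rewrite odd_tperm neq_lift.
    rewrite -(ceval_perm _ _ hc.1); apply: eq_ceval => a; rewrite /s /arrow.
    case: (unliftP ord0 a) => [b|] ->.
      by rewrite (ord1 b) tpermR fcons0 fconsS.
    by rewrite tpermL fcons0 fconsS.
  move=> v /andP[vi vSS]; apply/eqP; apply: contraT => nz.
  have [vinj hv] := ceval_neq0 hc.1 nz; rewrite arrow_image in hv.
  have vS : v != ordS i.
    by apply/eqP => e; have := vinj ord0 (lift ord0 ord0); rewrite fcons0 fconsS => /(_ e).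
  case: (polygon_edge vS hv) => [/ordS_inj|] e; last by rewrite e eqxx in vSS.
  by rewrite e eqxx in vi.
have all0 i : ceval c (arrow i (ordS i)) = 0.
  case: i => k; elim: k => [|k IH] hk; first by rewrite -[RHS]c0; apply: eq_ceval => a;
    congr (arrow _ (ordS _) _); apply: val_inj.
  have hk' : (k < m)%N by apply: ltn_trans hk.
  rewrite -(IH hk') -[RHS]step; congr (ceval c (arrow _ (ordS _))); apply: val_inj => /=;
  by rewrite modn_small.
apply: chain_eq0 => T; apply/eqP; apply: contraT => nz.
have [Ti hT] := ceval_neq0 hc.1 nz.
move: nz; rewrite (eq_ceval _ (arrowE T)).
have T01 : T ord0 != T ord_max by rewrite (inj_eq Ti).
have : [set T ord0; T ord_max] \in polygon m.
  by rewrite -arrow_image -(eq_imset _ (arrowE T)).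
case/(polygon_edge T01) => e; first by rewrite e all0 eqxx.
pose s : 'S_2 := tperm ord0 ord_max.
rewrite (@eq_ceval _ _ c _ (fun a => arrow (T ord_max) (ordS (T ord_max)) (s a))).
  by rewrite (ceval_perm _ _ hc.1) all0 mulr0 eqxx.
have mx : ord_max = lift ord0 ord0 :> 'I_2 by apply: val_inj.
move=> a; rewrite /s /arrow; case: (unliftP ord0 a) => [b|] ->.
  by rewrite (ord1 b) -mx tpermR fcons0 mx fconsS.
by rewrite tpermL fcons0 mx fconsS -mx.
Qed.

End Polygon.

(** * Degrees *)

Definition pushL (V W : Type) k (f : V -> W) (L : seq (int * ('I_k -> V))) :
    seq (int * ('I_k -> W)) :=
  [seq (x.1, f \o x.2) | x <- L].

(* The signed number of oriented simplices of [L] labelled 1, ..., k. *)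
Definition deg k (V : Type) (L : seq (int * ('I_k -> V))) (f : V -> nat) : int :=
  osum (pushL f L) (fun i : 'I_k => i.+1).

(** Labels are natural numbers, so a suspension can shift them by one without a change of type; they
    become vertices of the standard sphere only at the end. *)
Definition join_label m1 m2 (f1 : 'I_m1 -> nat) (f2 : 'I_m2 -> nat)
    (v : 'I_(m1 + m2)) : nat :=
  match split v with inl a => f1 a | inr b => f2 b end.

Lemma join_label_fcat m1 m2 k1 k2 (f1 : 'I_m1 -> nat) (f2 : 'I_m2 -> nat)
    (F : 'I_k1 -> 'I_m1) (G : 'I_k2 -> 'I_m2) :
  join_label f1 f2 \o fcat (lshift m2 \o F) (@rshift m1 m2 \o G)
    =1 fcat (f1 \o F) (f2 \o G).
Proof.
move=> i; rewrite /join_label /=; case: (split_ordP i) => j ->.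
  by rewrite !fcatl /= (unsplitK (inl (F j) : 'I_m1 + 'I_m2)).
by rewrite !fcatr /= (unsplitK (inr (G j) : 'I_m1 + 'I_m2)).
Qed.

(** Label 1 can be hit together with [2, ..., n + 2] only through the pole labelled 1, since [L]
    must supply the other [n + 1] labels; that pole has sign +1 in [std_sphereL 0]. Facets at the
    pole labelled 0 are not counted. *)
Lemma deg_suspension n m (L : seq (int * ('I_n.+1 -> 'I_m))) f :
  @deg n.+2 _ (joinL (std_sphereL 0) L)
    (join_label (fun b : 'I_2 => b : nat) (fun v => (f v).+1)) = deg L f.
Proof.
rewrite /deg /osum /pushL big_map /joinL big_allpairs_dep /= /std_sphereL 2!big_map.
rewrite big_enum /= !big_ord_recl big_ord0 addr0 /= [X in _ + X]big1 ?addr0.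
  apply: eq_bigr => y _; rewrite expr0 mul1r; congr (_ * _).
  have labE : join_label (fun b : 'I_2 => b : nat) (fun v => (f v).+1)
      \o @fcat _ 1 n.+1 (lshift m \o lift ord0) (@rshift 2 m \o y.2)
      =1 @fcat _ 1 n.+1 (fun=> 1%N) (fun i => (f (y.2 i)).+1).
    move=> i; rewrite [LHS](@join_label_fcat _ _ 1 n.+1).
    by rewrite /fcat; case: split => // a; rewrite (ord1 a).
  have succE : (fun i : 'I_n.+2 => i.+1) =1 @fcat _ 1 n.+1 (fun=> 1%N) (fun i => i.+2).
    move=> i; case: (@split_ordP 1 n.+1 i) => j ->; rewrite ?fcatl ?fcatr //=.
    by rewrite (ord1 j).
  rewrite (eq_osimp labE succE).
  rewrite osimp_fcat // osimp_self ?mul1r; last by move=> i j _; rewrite (ord1 i) (ord1 j).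
  exact: (@osimp_inj _ _ _ succn _ _ succn_inj).
move=> y _; rewrite (@eq_osimp _ _ _
    (@fcat _ 1 n.+1 (fun=> 0%N) (fun i => (f (y.2 i)).+1)) _ (fun i => i.+1)) //.
  by rewrite osimp_tr (@osimp_notin _ _ _ _ (@lshift 1 n.+1 ord0)) ?mulr0 // => j;
    rewrite fcatl.
move=> i; rewrite [LHS](@join_label_fcat _ _ 1 n.+1) /fcat; case: split => // a /=.
by rewrite (ord1 a).
Qed.

(** * Counting labelled facets of a join of two polygons *)

Lemma sum_triples (V : nmodType) (g : nat -> V) Q :
  \sum_(i < 3 * Q) g i = \sum_(b < Q) (g (3 * b)%N + g (3 * b).+1 + g (3 * b).+2).
Proof.
elim: Q => [|Q IH]; first by rewrite !big_ord0.
rewrite [RHS]big_ord_recr -IH mulnS -[(3 + _)%N]/(3 * Q).+3 !big_ord_recr /=.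
by rewrite !addrA.
Qed.

(** Every third vertex is labelled 0, where [h] vanishes, so in each block of three edges only the
    middle one survives. *)
Lemma sum_polygon_labels (h : nat -> nat -> int) (l : nat -> nat) P :
  (forall b, l (3 * b)%N = 0%N) -> (forall x, h 0%N x = 0) -> (forall x, h x 0%N = 0) ->
  \sum_(i < (3 * P).+3) h (l i) (l (ordS i))
    = \sum_(b < P.+1) h (l (3 * b).+1) (l (3 * b).+2).
Proof.
move=> l0 h0l h0r.
have := @sum_triples int (fun i => h (l i) (l (i.+1 %% (3 * P).+3)%N)) P.+1.
rewrite mulnS -[(3 + _)%N]/(3 * P).+3 => ->; apply: eq_bigr => b _.
have hb := ltn_ord b.
rewrite l0 h0l add0r (@modn_small (3 * b).+2); last by lia.
rewrite [X in _ + X](_ : _ = 0) ?addr0 //.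
have e : ((3 * b).+3 %% (3 * P).+3)%N = (3 * (b.+1 %% P.+1))%N.
  by rewrite -[(3 * P).+3]/(3 + 3 * P)%N -[(3 * b).+3]/(3 + 3 * b)%N -!mulnS muln_modr.
by rewrite e l0 h0r.
Qed.

(** The contribution of a tetrahedron with these labels to the degree over 1234: a sign, or 0 if it
    is not mapped onto that facet. *)
Definition quad (x y z w : nat) : int :=
  osimp (@fcat _ 2 2 (arrow x y) (arrow z w)) (fun i => i.+1).

Lemma quadE x y z w :
  @fcat _ 2 2 (arrow x y) (arrow z w) =1 (fun i : 'I_4 => nth 0%N [:: x; y; z; w] i).
Proof.
case=> [[|[|[|[|//]]]] h].
- by rewrite (_ : Ordinal h = lshift 2 ord0) ?fcatl ?arrow0 //; apply: val_inj.
- by rewrite (_ : Ordinal h = lshift 2 ord_max) ?fcatl ?arrow1 //; apply: val_inj.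
- by rewrite (_ : Ordinal h = rshift 2 ord0) ?fcatr ?arrow0 //; apply: val_inj.
by rewrite (_ : Ordinal h = rshift 2 ord_max) ?fcatr ?arrow1 //; apply: val_inj.
Qed.

Lemma quad0 x y z w : 0%N \in [:: x; y; z; w] -> quad x y z w = 0.
Proof.
move=> /(nthP 0%N)[k hk e]; rewrite /quad (eq_osimp (quadE _ _ _ _) (frefl _)).
by rewrite osimp_tr (@osimp_notin _ _ _ _ (Ordinal hk)) // => j; rewrite e.
Qed.

Lemma quad_rep x y z w : ~~ uniq [:: x; y; z; w] -> quad x y z w = 0.
Proof.
rewrite /quad (eq_osimp (quadE _ _ _ _) (frefl _)).
move=> /(uniqPn 0%N)[i [j [ij j4 e]]]; pose i' := Ordinal (ltn_trans ij j4).
apply: (@osimp_rep _ _ _ _ i' (Ordinal j4)) => //.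
by rewrite -(inj_eq val_inj) /= ltn_eqF.
Qed.

Lemma quad1234 : quad 1 2 3 4 = 1.
Proof.
rewrite /quad (eq_osimp (quadE _ _ _ _) (frefl _)).
rewrite -[RHS](@osimp_self _ 4 (fun i => i.+1)) => [|i j [] /val_inj //].
by apply: eq_osimp => // -[[|[|[|[|//]]]] h].
Qed.

(** A 3-cycle takes 1234 to 1342, so the sign is positive; this is why the second polygon ends with
    042 and not 024. *)
Lemma quad1342 : quad 1 3 4 2 = 1.
Proof.
pose o1 : 'I_4 := @Ordinal 4 1 isT; pose o2 : 'I_4 := @Ordinal 4 2 isT.
pose o3 : 'I_4 := @Ordinal 4 3 isT; pose s : 'S_4 := (tperm o1 o2 * tperm o1 o3)%g.
rewrite /quad (eq_osimp (quadE _ _ _ _) (frefl _)).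
rewrite (@eq_osimp _ _ _ (fun i => (s i).+1) _ (fun i => i.+1)) //; last first.
  case=> [[|[|[|[|//]]]] h]; rewrite /s permM.
  - by rewrite !tpermD.
  - by rewrite (_ : Ordinal h = o1) ?tpermL ?tpermD //; apply: val_inj.
  - by rewrite (_ : Ordinal h = o2) ?tpermR ?tpermL //; apply: val_inj.
  by rewrite (_ : Ordinal h = o3) ?(@tpermD _ o1 o2 o3) ?tpermR //; apply: val_inj.
rewrite osimp_tr (osimp_perm _ (fun i => i.+1)) osimp_self => [|i j [] /val_inj //].
by rewrite odd_permM !odd_tperm.
Qed.

(** The word [0 u v] repeated [N] times, followed by repetitions of [0 w x]. *)
Definition polygon_label N (u v w x : nat) (i : nat) : nat :=
  let t := (i %% 3)%N in
  if t == 0%N then 0%N else if (i < 3 * N)%N then (if t == 1%N then u else v)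
  else (if t == 1%N then w else x).

Lemma polygon_label1 N u v w x b :
  polygon_label N u v w x (3 * b).+1 = if (b < N)%N then u else w.
Proof.
rewrite /polygon_label -[(3 * b).+1]addn1 mulnC modnMDl /=.
by congr (if _ then _ else _); apply/idP/idP; lia.
Qed.

Lemma polygon_label2 N u v w x b :
  polygon_label N u v w x (3 * b).+2 = if (b < N)%N then v else x.
Proof.
rewrite /polygon_label -[(3 * b).+2]addn2 mulnC modnMDl /=.
by congr (if _ then _ else _); apply/idP/idP; lia.
Qed.

Lemma polygon_label0 N u v w x b : polygon_label N u v w x (3 * b) = 0%N.
Proof. by rewrite /polygon_label modnMr. Qed.

Lemma polygon_label_le N u v w x M i :
  (u <= M)%N -> (v <= M)%N -> (w <= M)%N -> (x <= M)%N ->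
  (polygon_label N u v w x i <= M)%N.
Proof. by move=> *; rewrite /polygon_label; do ![case: ifP => // _]. Qed.

(** The first polygon has [N.+1] blocks 012 and [r] blocks 013, the second [q] blocks 034 and one
    block 042. Each block 012 meets the [q] edges 34, each block 013 the single edge 42. *)
Lemma deg_polygons N r q :
  deg (joinL (polygonL (3 * (N + r)).+3) (polygonL (3 * q).+3))
    (join_label (fun i => polygon_label N.+1 1 2 1 3 i)
                (fun i => polygon_label q 3 4 4 2 i))
  = (N.+1 * q + r)%:Z.
Proof.
rewrite /deg /osum /pushL big_map /joinL big_allpairs_dep /= /polygonL big_map big_enum /=.
pose f1 := polygon_label N.+1 1 2 1 3; pose f2 := polygon_label q 3 4 4 2.
pose h x y := \sum_(j < (3 * q).+3) quad x y (f2 j) (f2 (ordS j)).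
rewrite (eq_bigr (fun i : 'I__ => h (f1 i) (f1 (ordS i)))) => [|i _]; last first.
  rewrite big_map big_enum /=; apply: eq_bigr => j _; rewrite !mul1r.
  apply: eq_osimp => // a; rewrite [LHS](@join_label_fcat _ _ 2 2) /fcat /=.
  by case: split => b; rewrite /arrow /fcons /=; case: unlift.
rewrite sum_polygon_labels; first last.
- by move=> x; rewrite /h big1 // => j _; rewrite quad0 // !inE eqxx ?orbT.
- by move=> x; rewrite /h big1 // => j _; rewrite quad0 // !inE eqxx ?orbT.
- by move=> b; apply: polygon_label0.
under eq_bigr => b _.
  rewrite /h sum_polygon_labels; first last.
  - by move=> y; rewrite quad0 // !inE eqxx ?orbT.
  - by move=> y; rewrite quad0 // !inE eqxx ?orbT.
  - by move=> c; apply: polygon_label0.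
  under eq_bigr => c _ do rewrite /f1 /f2 !polygon_label1 !polygon_label2.
  rewrite big_ord_recr /= ltnn.
  under eq_bigr => c _ do rewrite ltn_ord.
  rewrite sumr_const card_ord.
  over.
rewrite -addSn big_split_ord /=.
rewrite (eq_bigr (fun=> q%:Z)) => [|i _]; last first.
  by rewrite ltn_ord quad1234 quad_rep // addr0 -natz.
rewrite [X in _ + X](eq_bigr (fun=> 1)) => [|i _]; last first.
  by rewrite ltnNge leq_addr /= quad1342 quad_rep // mul0rn add0r.
rewrite !sumr_const !card_ord -!natz; lia.
Qed.

(** * From labelled facets to the homological degree *)

Lemma boundary_pushforward (V W : finType) (f : V -> W) k (c : chain V k.+1) :
  boundary (pushforward f c) = pushforward f (boundary c).
Proof.
apply/ffunP => u; rewrite !ffunE.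
under eq_bigr do rewrite ffunE.
under [RHS]eq_bigr do rewrite ffunE.
rewrite (exchange_big_dep predT) //=.
pose tl (t : {ffun 'I_k.+1 -> V}) : {ffun 'I_k -> V} := [ffun i => t (lift ord0 i)].
(* The vertex inserted in front of [u] must be the image of the head of [t], so the left side also
   sums [c] over the tuples whose tail maps to [u]. *)
rewrite [LHS](eq_bigr (fun t => if [ffun i => f (tl t i)] == u then c t else 0)).
  rewrite -big_mkcond [RHS]pair_big_dep /=.
  rewrite (reindex (fun p : {ffun 'I_k -> V} * V => Defs.cons_tuple p.2 p.1)) /=.
    apply: eq_bigl => -[t v] /=; rewrite andbT; congr (_ == _).
    by apply/ffunP => i; rewrite !ffunE liftK.
  exists (fun t => (tl t, t ord0)) => [[t v] _|t _] /=.
    congr pair; last by rewrite ffunE unlift_none.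
    by apply/ffunP => i; rewrite !ffunE liftK.
  apply/ffunP => i; rewrite ffunE.
  by case: (unliftP ord0 i) => [j|] ->; rewrite ?ffunE.
move=> t _; rewrite (eq_bigl (fun w => ([ffun i => f (tl t i)] == u) && (w == f (t ord0)))).
  case: ifP => h; last by rewrite big_pred0.
  by rewrite big_pred1_eq.
move=> w; apply/eqP/andP => [/ffunP h|[/eqP/ffunP h /eqP->]].
  split; last by have := h ord0; rewrite !ffunE unlift_none => ->.
  by apply/eqP/ffunP => i; have := h (lift ord0 i); rewrite !ffunE liftK => ->.
apply/ffunP => i; rewrite !ffunE; case: (unliftP ord0 i) => [j|] -> //.
by rewrite -h !ffunE.
Qed.

(** After expanding the determinants over permutations, each term is the indicator of a single
    tuple, and a map acts on such indicators directly. *)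
Lemma pushforward_chainL (V W : finType) (f : V -> W) k (L : seq (int * ('I_k -> V))) :
  pushforward f (chainL L) = chainL (pushL f L).
Proof.
apply/ffunP => u; rewrite !ffunE /osum /pushL big_map.
under [LHS]eq_bigr do rewrite ffunE /osum.
rewrite exchange_big /=; apply: eq_bigr => x _; rewrite -big_distrr /=; congr (_ * _).
rewrite [RHS]osimp_sum; under [LHS]eq_bigr do rewrite osimp_sum.
rewrite exchange_big /=; apply: eq_bigr => s _; rewrite -big_distrr /=; congr (_ * _).
pose t0 : {ffun 'I_k -> V} := [ffun i => x.2 (s i)].
have tE (t : {ffun 'I_k -> V}) : [forall i, t i == x.2 (s i)] = (t == t0).
  apply/forallP/eqP => [h|-> i]; last by rewrite ffunE.
  by apply/ffunP => i; rewrite ffunE; apply/eqP.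
under eq_bigr do rewrite tE.
rewrite big_mkcond (bigD1 t0) //= big1 ?addr0 => [|t /negPf->]; last by case: ifP.
rewrite eqxx; case: eqP => [/ffunP h|h].
  by rewrite (introT forallP) // => i; rewrite -h !ffunE.
case: forallP => // h'; case: h; apply/ffunP => i; rewrite !ffunE.
by have /eqP-> := h' i.
Qed.

Lemma simplicial_std_sphere (V : finType) n (K : {set {set V}}) (f : V -> 'I_n.+2) :
  (forall s, s \in K -> (#|s| <= n.+1)%N) -> is_simplicial K (std_sphere n) f.
Proof.
move=> hK s /hK sK; rewrite card_std_sphere.
exact: leq_trans (leq_imset_card _ _) sK.
Qed.

(** The pushed-forward cycle is a multiple [k] of the generator. Evaluation at [lift ord0], the
    facet with vertices [1, ..., n + 1] and coefficient 1, identifies [k] with [deg L f]. *)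
Lemma deg_has_degree (V : finType) n (K : {set {set V}}) (L : seq (int * ('I_n.+1 -> V)))
    (f : V -> nat) (g : V -> 'I_n.+2) :
  fundamental K L -> (forall v, val (g v) = f v) ->
  has_degree K (std_sphere n) g (chainL L) (chainL (std_sphereL n)) (deg L f).
Proof.
move=> hL gf.
have oL := fundamental_orientation hL.
have oS := fundamental_orientation (std_sphere_fundamental n).
split=> //.
have cyc : is_cycle (std_sphere n) (pushforward g (chainL L)).
  split; last first.
    by rewrite boundary_pushforward oL.1.2; apply/ffunP => u; rewrite !ffunE big1 // => t _; rewrite ffunE.
  rewrite pushforward_chainL; split=> [t s|t _].
    by rewrite !cevalE !ceval_chainL -osum_perm; apply: eq_osum => i; rewrite ffunE.
  by rewrite card_std_sphere (leq_trans (leq_imset_card _ _)) // card_ord.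
have [k [bk _]] := oS.2 _ cyc; suff <- : k = deg L f by [].
have [b hb e] := bk.
have b0 : b = 0.
  by apply: chain_eq0_card hb => s; rewrite card_std_sphere ltnS.
have : ceval (pushforward g (chainL L) - chainL (std_sphereL n) *~ k) (lift ord0) = 0.
  by rewrite e b0 ceval_boundary big1 // => v _; rewrite /ceval ffunE.
rewrite pushforward_chainL /ceval ffunE [X in _ + X]ffunE.
rewrite -[chainL (pushL g L) _]/(ceval _ _) ceval_chainL.
have -> : (chainL (std_sphereL n) *~ k) (finfun (lift ord0)) = k.
  have sE : chainL (std_sphereL n) (finfun (lift ord0)) = 1.
    by rewrite -[LHS]/(ceval _ _) ceval_chainL osum_std_sphere1.
  case: k {bk e} => k; first by rewrite -pmulrn ffunMnE sE natz.
  by rewrite !NegzE !mulrNz -!pmulrn ffunE ffunMnE sE natz.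
move=> /eqP; rewrite subr_eq0 => /eqP <-.
rewrite /deg /osum /pushL !big_map; apply: eq_bigr => x _ /=; congr (_ * _).
rewrite -(@osimp_inj _ _ _ val _ _ val_inj); apply: eq_osimp => i /=.
  by rewrite gf.
by rewrite /bump.
Qed.

From mathcomp Require Import lra.
From mathcomp Require Import all_classical all_reals all_analysis.
Import numFieldNormedType.Exports.
Local Open Scope classical_set_scope.
Local Open Scope ring_scope.

(** * Fans *)

Section Fans.
Variable R : realType.

Definition cone m (K : {set {set 'I_m}}) (x : 'rV[R]_m) : Prop :=
  (forall v, 0 <= x ord0 v) /\ [set v | x ord0 v != 0]%SET \in K.

Definition homogeneous m k (f : 'rV[R]_m -> 'rV[R]_k) : Prop :=
  forall a x, 0 <= a -> f (a *: x) = a *: f x.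

(** Both maps are continuous on whole coordinate spaces, so they compose and multiply without
    subspace topologies; injectivity of [phi] is asked only on the cone. *)
Definition fan k m (K : {set {set 'I_m}}) : Prop :=
  exists (phi : 'rV[R]_m -> 'rV[R]_k) (psi : 'rV[R]_k -> 'rV[R]_m),
    [/\ continuous phi /\ homogeneous phi, continuous psi /\ homogeneous psi,
        (forall y, cone K (psi y)), (forall y, phi (psi y) = y) &
        (forall x, cone K x -> psi (phi x) = x)].

Lemma rV_continuous (T : topologicalType) m (f : T -> 'rV[R]_m) x :
  (forall i, {for x, continuous (fun y => f y ord0 i)}) -> {for x, continuous f}.
Proof.
move=> h A [P hP PA].
have hQ i : \forall y \near x, P ord0 i (f y ord0 i) by apply: (h i); exact: hP.
have : \forall y \near x, forall i : 'I_m, P ord0 i (f y ord0 i).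
  by apply: filter_forall.
by apply: filterS => y hy; apply: PA => i j; rewrite (ord1 i); apply: hy.
Qed.

Lemma coord_for (T : topologicalType) m (f : T -> 'rV[R]_m) x i :
  {for x, continuous f} -> {for x, continuous (fun y => f y ord0 i)}.
Proof.
move=> h; apply: (@continuous_comp _ _ _ f (fun M : 'rV[R]_m => M ord0 i)) => //.
exact: coord_continuous.
Qed.

Lemma continuous_for_sum (T : topologicalType) m (f : 'I_m -> T -> R) x :
  (forall i, {for x, continuous (f i)}) ->
  {for x, continuous (fun y => \sum_(i < m) f i y)}.
Proof.
elim: m f => [|m IH] f h.
  have -> : (fun y => \sum_(i < 0) f i y) = fun=> 0.
    by apply/funext => y; rewrite big_ord0.
  exact: cst_continuous.
have -> : (fun y => \sum_(i < m.+1) f i y)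
    = (fun y => \sum_(i < m) f (widen_ord (leqnSn m) i) y + f ord_max y).
  by apply/funext => y; rewrite big_ord_recr.
apply: cvgD; first exact: (IH (fun i => f (widen_ord (leqnSn m) i))).
exact: h.
Qed.

Lemma continuous_forB (T : topologicalType) (f g : T -> R) x :
  {for x, continuous f} -> {for x, continuous g} ->
  {for x, continuous (fun y => f y - g y)}.
Proof. by move=> cf cg; apply: cvgB. Qed.

Lemma continuous_forD (T : topologicalType) (f g : T -> R) x :
  {for x, continuous f} -> {for x, continuous g} ->
  {for x, continuous (fun y => f y + g y)}.
Proof. by move=> cf cg; apply: cvgD. Qed.

Lemma continuous_forZ (T : topologicalType) (f : T -> R) c x :
  {for x, continuous f} -> {for x, continuous (fun y => c * f y)}.
Proof. by move=> cf; apply: cvgM => //; exact: cvg_cst. Qed.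

Lemma continuous_forN (T : topologicalType) (f : T -> R) x :
  {for x, continuous f} -> {for x, continuous (fun y => - f y)}.
Proof. by move=> cf; apply: cvgN. Qed.

Lemma continuous_for_normalize (T : topologicalType) m (s : T -> R) (f : T -> 'rV[R]_m) x :
  s x != 0 -> {for x, continuous s} -> {for x, continuous f} ->
  {for x, continuous (fun y => (s y)^-1 *: f y)}.
Proof.
move=> s0 cs cf; apply: rV_continuous => i.
have -> : (fun y => ((s y)^-1 *: f y) ord0 i) = (fun y => (s y)^-1 * f y ord0 i).
  by apply/funext => y; rewrite mxE.
by apply: cvgM; [exact: cvgV|exact: coord_for].
Qed.

Lemma continuous_for_norm (T : topologicalType) m (f : T -> 'rV[R]_m) x :
  {for x, continuous f} ->
  {for x, continuous (fun y => Num.sqrt (\sum_(i < m) f y ord0 i ^+ 2))}.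
Proof.
move=> cf; apply: (@continuous_comp _ _ _ (fun y => \sum_(i < m) f y ord0 i ^+ 2)).
  apply: continuous_for_sum => j.
  have -> : (fun y => f y ord0 j ^+ 2) = (fun y => f y ord0 j * f y ord0 j).
    by apply/funext => y; rewrite expr2.
  by apply: cvgM; exact: coord_for.
exact: sqrt_continuous.
Qed.

Lemma fan_transfer k m m' (K : {set {set 'I_m}}) (K' : {set {set 'I_m'}})
    (alpha : 'rV[R]_m' -> 'rV[R]_m) (beta : 'rV[R]_m -> 'rV[R]_m') :
  continuous alpha -> homogeneous alpha -> continuous beta -> homogeneous beta ->
  (forall x, cone K' x -> cone K (alpha x)) -> (forall x, cone K x -> cone K' (beta x)) ->
  (forall x, alpha (beta x) = x) -> (forall x, cone K' x -> beta (alpha x) = x) ->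
  fan k K -> fan k K'.
Proof.
move=> ca ha cb hb ka kb ab ba [phi [psi [[c1 h1] [c2 h2] kp pp pp']]].
exists (phi \o alpha), (beta \o psi); split.
- by split=> [x|a x a0 /=]; [apply: continuous_comp; [exact: ca|exact: c1]|rewrite ha ?h1].
- by split=> [x|a x a0 /=]; [apply: continuous_comp; [exact: c2|exact: cb]|rewrite h2 ?hb].
- by move=> y; apply: kb.
- by move=> y /=; rewrite ab pp.
by move=> x hx /=; rewrite pp' ?ba //; apply: ka.
Qed.

Lemma cone_join m1 m2 (K1 : {set {set 'I_m1}}) (K2 : {set {set 'I_m2}}) x :
  cone (join K1 K2) x <-> cone K1 (lsubmx x) /\ cone K2 (rsubmx x).
Proof.
have e1 : (lshift m2 @^-1: [set v | x ord0 v != 0] = [set v | lsubmx x ord0 v != 0])%SET.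
  by apply/setP => v; rewrite !inE mxE.
have e2 : (@rshift m1 m2 @^-1: [set v | x ord0 v != 0] = [set v | rsubmx x ord0 v != 0])%SET.
  by apply/setP => v; rewrite !inE mxE.
split=> [[x0 /joinP[]]|[[x1 k1] [x2 k2]]].
  by rewrite e1 e2 => k1 k2; split; split=> // v; rewrite mxE.
split; last by apply/joinP; rewrite e1 e2.
by move=> v; case: (split_ordP v) => a ->; [move: (x1 a)|move: (x2 a)]; rewrite mxE.
Qed.

Lemma fan_join k1 k2 m1 m2 (K1 : {set {set 'I_m1}}) (K2 : {set {set 'I_m2}}) :
  fan k1 K1 -> fan k2 K2 -> fan (k1 + k2) (join K1 K2).
Proof.
move=> [f1 [g1 [[cf1 hf1] [cg1 hg1] kg1 fg1 gf1]]] [f2 [g2 [[cf2 hf2] [cg2 hg2] kg2 fg2 gf2]]].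
have cl m m' : continuous (@lsubmx R 1 m m').
  move=> x; apply: rV_continuous => i.
  rewrite (_ : (fun y => _) = fun y : 'rV[R]_(m + m') => y ord0 (lshift m' i)).
    exact: coord_continuous.
  by apply/funext => y; rewrite mxE.
have cr m m' : continuous (@rsubmx R 1 m m').
  move=> x; apply: rV_continuous => i.
  rewrite (_ : (fun y => _) = fun y : 'rV[R]_(m + m') => y ord0 (rshift m i)).
    exact: coord_continuous.
  by apply/funext => y; rewrite mxE.
have crow a b c d (f : 'rV[R]_a -> 'rV[R]_c) (g : 'rV[R]_b -> 'rV[R]_d) :
    continuous f -> continuous g ->
    continuous (fun x : 'rV[R]_(a + b) => row_mx (f (lsubmx x)) (g (rsubmx x))).
  move=> cf cg x; apply: rV_continuous => i; case: (split_ordP i) => j ->.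
    rewrite (_ : (fun y => _) = fun y => (f \o lsubmx) y ord0 j).
      by apply/coord_for/continuous_comp; [exact: cl|exact: cf].
    by apply/funext => y; rewrite row_mxEl.
  rewrite (_ : (fun y => _) = fun y => (g \o rsubmx) y ord0 j).
    by apply/coord_for/continuous_comp; [exact: cr|exact: cg].
  by apply/funext => y; rewrite row_mxEr.
exists (fun x => row_mx (f1 (lsubmx x)) (f2 (rsubmx x))),
       (fun y => row_mx (g1 (lsubmx y)) (g2 (rsubmx y))); split.
- by split; [exact: crow|move=> a x a0; rewrite !linearZ /= hf1 ?hf2 // scale_row_mx].
- by split; [exact: crow|move=> a x a0; rewrite !linearZ /= hg1 ?hg2 // scale_row_mx].
- by move=> y; apply/cone_join; rewrite row_mxKl row_mxKr.
- by move=> y; rewrite row_mxKl row_mxKr fg1 fg2 hsubmxK.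
by move=> x /cone_join[k1x k2x]; rewrite row_mxKl row_mxKr gf1 ?gf2 ?hsubmxK.
Qed.

(** Each map is followed by normalization, to Euclidean norm 1 or to coordinate sum 1. By
    homogeneity the scalars pass through [phi] and [psi], and the second normalization undoes the
    first. *)
Lemma fan_homeo n m (K : {set {set 'I_m}}) : is_complex K -> fan n.+1 K ->
  homeomorphic (realization R K) (unit_sphere R n).
Proof.
move=> [K0 _] [phi [psi [[cf hf] [cg hg] kg fg gf]]].
have zero_cone : cone K (0 : 'rV[R]_m).
  split=> [v|]; first by rewrite mxE.
  by rewrite (_ : [set v | _]%SET = finset.set0) //; apply/setP => v; rewrite !inE mxE eqxx.
have phi0 : phi 0 = 0 by rewrite -[X in phi X](scale0r (0 : 'rV[R]_m)) hf ?scale0r.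
pose N (y : 'rV[R]_n.+1) := Num.sqrt (\sum_(i < n.+1) y ord0 i ^+ 2).
pose S (x : 'rV[R]_m) := \sum_(v < m) x ord0 v.
have sq0 (y : 'rV[R]_n.+1) : 0 <= \sum_(i < n.+1) y ord0 i ^+ 2.
  by apply: sumr_ge0 => i _; exact: sqr_ge0.
have N0 y : N y = 0 -> y = 0.
  move/eqP; rewrite sqrtr_eq0 => h; apply/rowP => i; rewrite mxE.
  have /eqP : \sum_(i < n.+1) y ord0 i ^+ 2 = 0 by apply/eqP; rewrite eq_le h sq0.
  rewrite psumr_eq0 => [/allP /(_ i)|j _]; last exact: sqr_ge0.
  by rewrite mem_index_enum sqrf_eq0 => /(_ isT) /eqP.
have S0 x : cone K x -> S x = 0 -> x = 0.
  move=> [x0 _] /eqP; rewrite psumr_eq0 // => /allP h; apply/rowP => i.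
  by rewrite mxE; apply/eqP/(implyP (h i _)) => //; rewrite mem_index_enum.
have Npos x : realization R K x -> 0 < N (phi x).
  move=> [x0 x1 xK]; rewrite lt_neqAle sqrtr_ge0 andbT eq_sym; apply/eqP => /N0 e.
  have := gf x (conj x0 xK); rewrite e -phi0 gf // => x00.
  by move: x1; rewrite -x00 big1 => [/eqP|v _]; rewrite ?mxE // eq_sym oner_eq0.
have Spos y : unit_sphere R n y -> 0 < S (psi y).
  move=> y1; have [p0 pK] := kg y.
  rewrite lt_neqAle sumr_ge0 // andbT eq_sym; apply/eqP => /(S0 _ (kg y)) e.
  have y0 : y = 0 by rewrite -(fg y) e phi0.
  move: y1; rewrite /unit_sphere /= y0 big1 => [/eqP|v _]; rewrite ?mxE ?expr0n //.
  by rewrite eq_sym oner_eq0.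
exists (fun x => (N (phi x))^-1 *: phi x), (fun y => (S (psi y))^-1 *: psi y); split.
- split; apply: continuous_in_subspaceT => x; rewrite inE => hx.
    apply: (@continuous_for_normalize 'rV[R]_m _ (fun x => N (phi x)) phi);
      [by rewrite gt_eqF // Npos| |exact: cf].
    exact/continuous_for_norm/cf.
  apply: (@continuous_for_normalize 'rV[R]_n.+1 _ (fun y => S (psi y)) psi);
    [by rewrite gt_eqF // Spos| |exact: cg].
  by apply: continuous_for_sum => j; exact/coord_for/cg.
- move=> x hx; rewrite /unit_sphere /=.
  under eq_bigr do rewrite mxE exprMn.
  rewrite -big_distrr /= exprVn sqr_sqrtr // mulVf //.
  by apply: contraTneq (Npos _ hx) => e; rewrite /N e sqrtr0 ltxx.
- move=> y hy; have [p0 pK] := kg y; have Sy := Spos _ hy; split.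
  + by move=> v; rewrite mxE mulr_ge0 // invr_ge0 ltW.
  + under eq_bigr do rewrite mxE.
    by rewrite -big_distrr /= mulVf // gt_eqF.
  rewrite (_ : [set v | _]%SET = [set v | psi y ord0 v != 0]%SET) //.
  by apply/setP => v; rewrite !inE mxE mulf_eq0 invr_eq0 gt_eqF.
- move=> x hx; have Nx := Npos _ hx; have [x0 x1 xK] := hx.
  rewrite hg ?invr_ge0 ?ltW // gf //.
  rewrite (_ : S _ = (N (phi x))^-1); last first.
    by rewrite /S; under eq_bigr do rewrite mxE; rewrite -big_distrr /= x1 mulr1.
  by rewrite invrK scalerA divff ?scale1r // gt_eqF.
move=> y hy; have Sy := Spos _ hy.
rewrite hf ?invr_ge0 ?ltW // fg.
rewrite (_ : N _ = (S (psi y))^-1); first by rewrite invrK scalerA divff ?scale1r // gt_eqF.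
rewrite /N; under eq_bigr do rewrite mxE exprMn.
by rewrite -big_distrr /= hy mulr1 sqrtr_sqr ger0_norm // invr_ge0 ltW.
Qed.

End Fans.

(** * Fans of simplex boundaries and polygons *)

Section FanExamples.
Variable R : realType.

(** The default value 0 counts as one more coordinate, that of the vertex [ord0] in the fan of the
    simplex boundary. *)
Definition min0 m (y : 'rV[R]_m) : R := \big[Num.min/0]_(i < m) y ord0 i.

Lemma min0_le0 m (y : 'rV[R]_m) : min0 y <= 0.
Proof. exact: bigmin_le_id. Qed.

Lemma min0_le m (y : 'rV[R]_m) i : min0 y <= y ord0 i.
Proof. exact: bigmin_le_cond. Qed.

Lemma min0_attained m (y : 'rV[R]_m) : min0 y = 0 \/ exists i, min0 y = y ord0 i.
Proof.
rewrite /min0; elim/big_ind: _ => [|a b ha hb|i _]; first by left.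
  by rewrite /Num.min; case: ifP.
by right; exists i.
Qed.

Lemma min0_unique m (y : 'rV[R]_m) c :
  c <= 0 -> (forall i, c <= y ord0 i) -> (c = 0 \/ exists i, c = y ord0 i) -> min0 y = c.
Proof.
move=> c0 cy hc; apply/le_anti/andP; split.
  by case: hc => [->|[i ->]]; [exact: min0_le0|exact: min0_le].
by case: (min0_attained y) => [->|[i ->]].
Qed.

Lemma continuous_min0 m : continuous (@min0 m).
Proof.
move=> x; rewrite /min0.
elim: (index_enum _) => [|i s IH].
  have -> : (fun y : 'rV[R]_m => \big[Num.min/0]_(i <- [::]) y ord0 i) = fun=> 0.
    by apply/funext => y; rewrite big_nil.
  exact: cst_continuous.
have -> : (fun y : 'rV[R]_m => \big[Num.min/0]_(j <- i :: s) y ord0 j) =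
    (fun y => y ord0 i) \min (fun y => \big[Num.min/0]_(j <- s) y ord0 j).
  by apply/funext => y; rewrite big_cons.
by apply: continuous_min => //; exact: coord_continuous.
Qed.

(** [phi] is the quotient by the diagonal, normalized by the coordinate at [ord0]. Each class has
    exactly one representative with minimal coordinate 0, that is, nonnegative with a vertex missing
    from its support; [psi] selects it. *)
Lemma fan_std_sphere n : fan R n.+1 (std_sphere n).
Proof.
pose phi (x : 'rV[R]_n.+2) : 'rV[R]_n.+1 := \row_i (x ord0 (lift ord0 i) - x ord0 ord0).
pose psi (y : 'rV[R]_n.+1) : 'rV[R]_n.+2 :=
  \row_i (if unlift ord0 i is Some j then y ord0 j - min0 y else - min0 y).
have psi0 y : psi y ord0 ord0 = - min0 y by rewrite mxE unlift_none.
have psiS y i : psi y ord0 (lift ord0 i) = y ord0 i - min0 y by rewrite mxE liftK.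
exists phi, psi; split.
- split=> [x|a x a0].
    apply: rV_continuous => i.
    have -> : (fun y => phi y ord0 i) = (fun y : 'rV[R]_n.+2 => y ord0 (lift ord0 i) - y ord0 ord0).
      by apply/funext => y; rewrite mxE.
    by apply: continuous_forB; exact: coord_continuous.
  by apply/rowP => i; rewrite !mxE mulrBr.
- split=> [y|a y a0].
    apply: rV_continuous => i; case: (unliftP ord0 i) => [j|] ->.
      have -> : (fun y => psi y ord0 (lift ord0 j)) = (fun y => y ord0 j - min0 y).
        by apply/funext => z; rewrite psiS.
      by apply: continuous_forB; [exact: coord_continuous|exact: continuous_min0].
    have -> : (fun y => psi y ord0 ord0) = (fun y => - min0 y).
      by apply/funext => z; rewrite psi0.
    by apply: continuous_forN; exact: continuous_min0.
  have e : min0 (a *: y) = a * min0 y.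
    apply: min0_unique.
    - by rewrite mulr_ge0_le0 // min0_le0.
    - by move=> i; rewrite mxE ler_wpM2l // min0_le.
    by case: (min0_attained y) => [->|[i ->]]; [left; rewrite mulr0|right; exists i; rewrite mxE].
  apply/rowP => i; rewrite [RHS]mxE; case: (unliftP ord0 i) => [j|] ->.
    by rewrite !psiS e mxE mulrBr.
  by rewrite !psi0 e mulrN.
- move=> y; split.
    move=> v; case: (unliftP ord0 v) => [j|] ->; rewrite ?psiS ?psi0.
      by rewrite subr_ge0 min0_le.
    by rewrite oppr_ge0 min0_le0.
  apply/std_sphereP; case: (min0_attained y) => [e|[i e]].
    by exists ord0; rewrite inE negbK psi0 e oppr0.
  by exists (lift ord0 i); rewrite inE negbK psiS e subrr.
- by move=> y; apply/rowP => i; rewrite mxE psiS psi0 opprK subrK.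
move=> x [x0 /std_sphereP[v]]; rewrite inE negbK => /eqP xv.
have e : min0 (phi x) = - x ord0 ord0.
  apply: min0_unique; first by rewrite oppr_le0.
    by move=> i; rewrite mxE lerDr.
  case: (unliftP ord0 v) xv => [j|] -> xv; last by left; rewrite xv oppr0.
  by right; exists j; rewrite mxE xv sub0r.
apply/rowP => i; case: (unliftP ord0 i) => [j|] ->.
  by rewrite psiS e opprK mxE subrK.
by rewrite psi0 e opprK.
Qed.

Lemma val_ordS m (i : 'I_m) : val (ordS i) = if i.+1 == m then 0%N else i.+1.
Proof.
rewrite /=; case: eqP => [->|/eqP h]; first by rewrite modnn.
by rewrite modn_small // ltn_neqAle h ltn_ord.
Qed.

Lemma cone_polygon m (x : 'rV[R]_m) i :
  (forall v, 0 <= x ord0 v) -> (forall j, x ord0 j != 0 -> j = i \/ j = ordS i) ->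
  cone (polygon m) x.
Proof.
move=> x0 h; split=> //; rewrite inE; apply/orP; right; apply/existsP; exists i.
by apply/fintype.subsetP => j; rewrite !inE => /h[]->; rewrite eqxx ?orbT.
Qed.

Lemma cone_polygonP m (x : 'rV[R]_m.+1) : cone (polygon m.+1) x ->
  exists i, forall j, x ord0 j != 0 -> j = i \/ j = ordS i.
Proof.
case=> _; rewrite inE => /orP[/eqP/setP h|/existsP[i /fintype.subsetP h]].
  by exists ord0 => j xj; have := h j; rewrite !inE xj.
by exists i => j xj; have := h j; rewrite !inE xj => /(_ isT) /orP[]/eqP; [left|right].
Qed.

(* Subdividing the edge between the last and the first vertex by a new vertex,
   which becomes vertex 0. *)
Lemma fan_polygonS p : fan R 2 (polygon p.+3) -> fan R 2 (polygon p.+4).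
Proof.
(* [e] marks the ends of the subdivided edge. [alpha] replaces the new vertex by the sum of the two
   ends; [beta] moves the common part [mn] of the end coordinates to the new vertex. *)
pose e (j : 'I_p.+3) : R := ((j == ord0) || (j == ord_max))%:R.
pose mn (x : 'rV[R]_p.+3) : R := Num.min (x ord0 ord0) (x ord0 ord_max).
pose alpha (x : 'rV[R]_p.+4) : 'rV[R]_p.+3 :=
  \row_j (x ord0 (lift ord0 j) + e j * x ord0 ord0).
pose beta (x : 'rV[R]_p.+3) : 'rV[R]_p.+4 :=
  \row_i (if unlift ord0 i is Some j then x ord0 j - e j * mn x else mn x).
have beta0 x : beta x ord0 ord0 = mn x by rewrite mxE unlift_none.
have betaS x i : beta x ord0 (lift ord0 i) = x ord0 i - e i * mn x by rewrite mxE liftK.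
have e0 : e ord0 = 1 by rewrite /e eqxx.
have em : e ord_max = 1 by rewrite /e eqxx orbT.
have cmn : continuous mn.
  move=> x; rewrite /mn.
  by apply: (@continuous_min _ _ (fun x : 'rV[R]_p.+3 => x ord0 ord0)
    (fun x : 'rV[R]_p.+3 => x ord0 ord_max)); exact: coord_continuous.
apply: (@fan_transfer _ _ _ _ _ _ alpha beta).
- move=> x; apply: rV_continuous => i.
  have -> : (fun y => alpha y ord0 i)
      = (fun y : 'rV[R]_p.+4 => y ord0 (lift ord0 i) + e i * y ord0 ord0).
    by apply/funext => y; rewrite mxE.
  apply: continuous_forD; first exact: coord_continuous.
  by apply: continuous_forZ; exact: coord_continuous.
- by move=> a x a0; apply/rowP => i; rewrite !mxE mulrDr mulrCA.
- move=> x; apply: rV_continuous => i; case: (unliftP ord0 i) => [j|] ->.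
    have -> : (fun y => beta y ord0 (lift ord0 j)) = (fun y => y ord0 j - e j * mn y).
      by apply/funext => y; rewrite betaS.
    apply: continuous_forB; first exact: coord_continuous.
    by apply: continuous_forZ; exact: cmn.
  have -> : (fun y => beta y ord0 ord0) = mn by apply/funext => y; rewrite beta0.
  exact: cmn.
- move=> a x a0.
  have mnZ : mn (a *: x) = a * mn x by rewrite /mn !mxE minr_pMr.
  apply/rowP => i; rewrite [RHS]mxE; case: (unliftP ord0 i) => [j|] ->.
    by rewrite !betaS mnZ mxE mulrBr mulrCA.
  by rewrite !beta0 mnZ.
- move=> x hx; have [x0 _] := hx; have [i hi] := cone_polygonP hx.
  have a0 j : 0 <= alpha x ord0 j.
    by rewrite mxE addr_ge0 // mulr_ge0 // /e ler0n.
  have supp j : alpha x ord0 j != 0 ->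
      x ord0 (lift ord0 j) != 0 \/ ((j == ord0) || (j == ord_max)) /\ x ord0 ord0 != 0.
    rewrite mxE; case: (eqVneq (x ord0 (lift ord0 j)) 0) => [->|]; last by left.
    by rewrite add0r mulf_eq0 negb_or /e pnatr_eq0 eqb0 negbK => /andP[h1 h2]; right.
  have [x00|x00] := eqVneq (x ord0 ord0) 0.
    case: (unliftP ord0 i) hi => [i'|] -> hi.
      apply: (@cone_polygon _ _ i') => // j /supp[/hi|[_ /eqP//]].
      case=> [/lift_inj->|]; first by left.
      move/(congr1 val); rewrite val_ordS /= /bump /= => h; right; apply: val_inj.
      by move: h; rewrite val_ordS /=; do ![case: eqP]; lia.
    apply: (@cone_polygon _ _ ord0) => // j /supp[/hi|[_ /eqP//]].
    case=> /(congr1 val); rewrite ?val_ordS /= /bump /= => h; first by lia.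
    by left; apply: val_inj => /=; lia.
  (* The new vertex occurs, so [x] lies over one of the two halves, and its image over the old edge
     from [ord_max] to [ord0]. *)
  have := hi _ x00; case=> [i0|].
    apply: (@cone_polygon _ _ ord_max) => // j /supp[/hi|[/orP[]/eqP-> _]].
    - rewrite -i0; case=> /(congr1 val); rewrite ?val_ordS /= /bump /= => h; first by lia.
      by right; apply: val_inj; rewrite val_ordS /= eqxx; lia.
    - by right; apply: val_inj; rewrite val_ordS /= eqxx.
    - by left.
  move/(congr1 val); rewrite val_ordS /= => i0.
  have im : nat_of_ord i = p.+3 by move: i0; case: eqP => // -[].
  apply: (@cone_polygon _ _ ord_max) => // j /supp[/hi|[/orP[]/eqP-> _]].
  - case=> /(congr1 val); rewrite ?val_ordS ?im /= ?eqxx /bump /= => h; last by lia.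
    by left; apply: val_inj => /=; lia.
  - by right; apply: val_inj; rewrite val_ordS /= eqxx.
  - by left.
- move=> x hx; have [x0 _] := hx; have [i hi] := cone_polygonP hx.
  have b0 v : 0 <= beta x ord0 v.
    case: (unliftP ord0 v) => [j|] ->; last by rewrite beta0 le_min !x0.
    rewrite betaS /e subr_ge0; case: (eqVneq j ord0) => [->|_] /=.
      by rewrite mul1r ge_min lexx.
    by case: eqP => [->|_]; rewrite ?mul1r ?mul0r // ge_min lexx orbT.
  (* On the subdivided edge, the smaller end coordinate becomes zero, which decides the half
     containing [beta x]. *)
  have [im|im] := eqVneq i ord_max.
    have hi' j : x ord0 j != 0 -> j = ord_max \/ j = ord0.
      move=> /hi[]->; first by left.
      by right; apply: val_inj; rewrite val_ordS im /= eqxx.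
    have supp j : beta x ord0 (lift ord0 j) != 0 -> x ord0 j != 0.
      apply: contraNneq => xj; rewrite betaS xj sub0r oppr_eq0 mulf_eq0.
      rewrite /e; case: (eqVneq j ord0) => [j0|_] /=.
        by rewrite /mn -j0 xj; rewrite min_l ?eqxx ?orbT // x0.
      by case: (eqVneq j ord_max) => [jm|_] /=; rewrite ?eqxx // /mn -jm xj min_r ?eqxx ?orbT // x0.
    have [le|le] := leP (x ord0 ord0) (x ord0 ord_max).
      have z : beta x ord0 (lift ord0 ord0) = 0 by rewrite betaS e0 mul1r /mn min_l ?subrr.
      apply: (@cone_polygon _ _ ord_max) => // v; case: (unliftP ord0 v) => [j|] -> h.
        case: (hi' _ (supp _ h)) => jE; rewrite jE ?z ?eqxx // in h *.
        by left; apply: val_inj.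
      by right; apply: val_inj; rewrite val_ordS /= eqxx.
    have z : beta x ord0 (lift ord0 ord_max) = 0.
      by rewrite betaS em mul1r /mn min_r ?subrr // ltW.
    apply: (@cone_polygon _ _ ord0) => // v; case: (unliftP ord0 v) => [j|] -> h.
      case: (hi' _ (supp _ h)) => jE; rewrite jE ?z ?eqxx // in h *.
      by right; apply: val_inj; rewrite val_ordS.
    by left.
  (* Any other edge misses one of the two ends, so [beta] merely renumbers the vertices. *)
  have mn0 : mn x = 0.
    have [z|z] := eqVneq (x ord0 ord0) 0; first by rewrite /mn z min_l.
    have [z'|z'] := eqVneq (x ord0 ord_max) 0; first by rewrite /mn z' min_r.
    have im' : nat_of_ord i <> p.+2 by move=> h; case/eqP: im; apply: val_inj.
    case: (hi _ z) => /(congr1 val); case: (hi _ z') => /(congr1 val);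
      rewrite ?val_ordS /=; do ?[case: eqP]; lia.
  apply: (@cone_polygon _ _ (lift ord0 i)) => // v; case: (unliftP ord0 v) => [j|] ->.
    rewrite betaS mn0 mulr0 subr0 => /hi[]->; first by left.
    have im' : nat_of_ord i <> p.+2 by move=> h; case/eqP: im; apply: val_inj.
    right; apply: val_inj; rewrite val_ordS /= /bump /=; have := val_ordS i => /= ->.
    by do ?[case: eqP]; lia.
  by rewrite beta0 mn0 eqxx.
- by move=> x; apply/rowP => j; rewrite mxE betaS beta0 subrK.
move=> x hx; have [x0 _] := hx; have [i hi] := cone_polygonP hx.
(* In the finer polygon the two old ends are not adjacent, so one of their coordinates is zero and
   the minimum is the coordinate of the new vertex. *)
have mnE : mn (alpha x) = x ord0 ord0.
  have z : x ord0 (lift ord0 ord0) = 0 \/ x ord0 (lift ord0 ord_max) = 0.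
    have [z|z] := eqVneq (x ord0 (lift ord0 ord0)) 0; first by left.
    have [z'|z'] := eqVneq (x ord0 (lift ord0 ord_max)) 0; first by right.
    by case: (hi _ z) => /(congr1 val); case: (hi _ z') => /(congr1 val);
      rewrite ?val_ordS /= /bump /=; do ?[case: eqP]; lia.
  rewrite /mn !mxE e0 em !mul1r; case: z => z; rewrite z add0r.
    by rewrite min_l // lerDr.
  by rewrite min_r // lerDr.
apply/rowP => v; case: (unliftP ord0 v) => [j|] ->.
  by rewrite betaS mnE mxE addrK.
by rewrite beta0.
Qed.

Lemma fan_polygon p : fan R 2 (polygon p.+3).
Proof.
elim: p => [|p]; last exact: fan_polygonS.
suff -> : polygon 3 = std_sphere 1 by exact: fan_std_sphere.
apply/setP => s; apply/idP/std_sphereP => [|[v vs]].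
  rewrite inE => /orP[/eqP->|/existsP[i /fintype.subsetP si]]; first by exists ord0; rewrite inE.
  exists (ordS (ordS i)); apply: contraT; rewrite negbK => /si.
  by rewrite !inE (negPf (ordSS_neq i)) (inj_eq (@ordS_inj 3)) (negPf (ordS_neq i)).
rewrite inE; apply/orP; right; apply/existsP; exists (ordS v); apply/fintype.subsetP => w ws.
have wv : nat_of_ord w <> nat_of_ord v by move=> /val_inj h; rewrite -h ws in vs.
have := ltn_ord w; have := ltn_ord v.
rewrite !inE -!(inj_eq val_inj) !val_ordS /=; move: wv => /=.
by do ?[case: eqP]; lia.
Qed.

End FanExamples.

(** * The construction *)

Section Construction.
Variable R : realType.

Definition labelled_sphere (n d m : nat) : Prop :=
  exists (K : {set {set 'I_m}}) (L : seq (int * ('I_n.+1 -> 'I_m))) (f : 'I_m -> nat),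
    [/\ fundamental K L, fan R n.+1 K, (forall v, [set v]%SET \in K),
        (forall v, (f v <= n.+1)%N) & deg L f = d%:Z].

Lemma join_vertex m1 m2 (K1 : {set {set 'I_m1}}) (K2 : {set {set 'I_m2}}) :
  is_complex K1 -> is_complex K2 ->
  (forall v, [set v]%SET \in K1) -> (forall v, [set v]%SET \in K2) ->
  forall v, [set v]%SET \in join K1 K2.
Proof.
move=> [k1 _] [k2 _] h1 h2 v; apply/joinP; case: (split_ordP v) => a ->.
  rewrite (_ : lshift m2 @^-1: _ = [set a])%SET; last first.
    by apply/setP => b; rewrite !inE (inj_eq (@lshift_inj _ _)).
  rewrite (_ : @rshift m1 m2 @^-1: _ = finset.set0)%SET //.
  by apply/setP => b; rewrite !inE eq_rlshift.
rewrite (_ : @rshift m1 m2 @^-1: _ = [set a])%SET; last first.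
  by apply/setP => b; rewrite !inE (inj_eq (@rshift_inj _ _)).
rewrite (_ : lshift m2 @^-1: _ = finset.set0)%SET //.
by apply/setP => b; rewrite !inE eq_lrshift.
Qed.

Lemma std_sphere_vertex n v : [set v]%SET \in std_sphere n.
Proof. by rewrite card_std_sphere cards1. Qed.

Lemma polygon_vertex m v : [set v]%SET \in polygon m.
Proof.
by rewrite inE; apply/orP; right; apply/existsP; exists v; rewrite finset.sub1set !inE eqxx.
Qed.

Lemma labelled_sphere3 N r q :
  labelled_sphere 3 (N.+1 * q + r) ((3 * (N + r)).+3 + (3 * q).+3).
Proof.
exists (join (polygon _) (polygon _)), (joinL (polygonL _) (polygonL _)),
  (join_label (fun i => polygon_label N.+1 1 2 1 3 i)
                (fun i => polygon_label q 3 4 4 2 i)); split.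
- exact: (join_fundamental (polygon_fundamental _) (polygon_fundamental _)).
- exact: (fan_join (fan_polygon R _) (fan_polygon R _)).
- exact: join_vertex (polygon_complex _) (polygon_complex _)
    (@polygon_vertex _) (@polygon_vertex _).
- by move=> v; rewrite /join_label; case: (fintype.split v) => i; apply: polygon_label_le.
exact: deg_polygons.
Qed.

Lemma labelled_sphere_suspension n d m :
  labelled_sphere n d m -> labelled_sphere n.+1 d (2 + m).
Proof.
move=> [K [L [f [hL fK vK fle dL]]]].
exists (join (std_sphere 0) K), (joinL (std_sphereL 0) L),
  (join_label (fun b : 'I_2 => b : nat) (fun v => (f v).+1)); split.
- exact: (join_fundamental (std_sphere_fundamental 0) hL).
- exact: (fan_join (fan_std_sphere R 0) fK).
- have [cK _ _ _ _] := hL.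
  by apply: join_vertex => //; [exact: std_sphere_complex|exact: std_sphere_vertex].
- move=> v; rewrite /join_label; case: (fintype.split v) => a; last by rewrite ltnS fle.
  by rewrite (leq_trans (ltnW (ltn_ord a))).
by rewrite deg_suspension.
Qed.

Lemma labelled_sphere_realizes n d m :
  labelled_sphere n d m -> realizes_degree R n d m.
Proof.
move=> [K [L [f [hL fK vK fle dL]]]]; have [cK dK _ _ _] := hL.
exists K, (fun v => inord (f v)), (chainL L), (chainL (std_sphereL n)); split=> //.
- exact: fan_homeo.
- exact: simplicial_std_sphere.
rewrite -dL; apply: deg_has_degree => // v.
by rewrite /= inordK // ltnS fle.
Qed.

(** With [N.+1] windings the remainder is at most [N], so everything but the term [3 q] is bounded
    independently of [d]. *)
Lemma realizes_degree_bound n d N : (3 <= n)%N ->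
  exists2 m, realizes_degree R n d m & (m <= 3 * (d %/ N.+1) + (6 * N + 6 + 2 * n))%N.
Proof.
move=> n3; pose q := (d %/ N.+1)%N; pose r := (d %% N.+1)%N.
have rN : (r <= N)%N by rewrite -ltnS ltn_mod.
have [m hm mle] : exists2 m, labelled_sphere n d m &
    (m = ((3 * (N + r)).+3 + (3 * q).+3) + 2 * (n - 3))%N.
  rewrite -(subnK n3) addnK addnC; elim: (n - 3)%N => [|j [m hm mE]].
    exists ((3 * (N + r)).+3 + (3 * q).+3)%N; last by rewrite muln0 addn0.
    by rewrite addn0 {1}(divn_eq d N.+1) mulnC; apply: labelled_sphere3.
  exists (2 + m)%N; last by lia.
  by rewrite addnS; apply: labelled_sphere_suspension.
exists m; first exact: labelled_sphere_realizes.
by rewrite -/q; lia.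
Qed.

End Construction.

(** * Passage to the limit *)

Theorem theorem1 (R : realType) (n : nat) (hn : (3 <= n)%N) :
  (lambda R n d / (d%:R)%:E)%E @[d --> \oo] --> 0%E.
Proof.
have lam0 d : (0 <= lambda R n d)%E.
  by apply/ereal_infP => _ [m _ <-]; rewrite lee_fin.
have ratio d (m : nat) : (0 < d)%N -> (lambda R n d <= m%:R%:E)%E ->
    (0 <= lambda R n d / d%:R%:E <= (m%:R / d%:R)%:E)%E.
  move=> d0 h; have dR : (d%:R : R) != 0 by rewrite pnatr_eq0 -lt0n.
  rewrite inver (negPf dR) mule_ge0 ?lee_fin ?invr_ge0 //=.
  by rewrite EFinM lee_wpmul2r // lee_fin invr_ge0.
have key e : 0 < e -> \forall d \near \oo, (0 <= lambda R n d / d%:R%:E <= e%:E)%E.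
  (* The allowance [e * d] is halved: [N.+1 > 6 / e] makes the term [3 * (d %/ N.+1)] at most
     [e * d / 2], and [d >= 2 * C / e] does the same for the constant [C]. *)
  move=> e0; pose N := Num.bound (6 / e); pose C := (6 * N + 6 + 2 * n)%N.
  near=> d.
  have [m hm mle] := @realizes_degree_bound R n d N hn.
  have d0 : (0 < d)%N by near: d; exact: nbhs_infty_gt.
  have lm : (lambda R n d <= m%:R%:E)%E.
    by apply: ereal_inf_lbound; exists m.
  have /andP[-> h] := ratio d m d0 lm; rewrite (le_trans h) // lee_fin.
  have dR : 0 < d%:R :> R by rewrite ltr0n.
  rewrite ler_pdivrMr //.
  have dC : 2 * C%:R / e <= d%:R by near: d; exact: nbhs_infty_ger.
  have dN : 6 / e < N.+1%:R.
    by rewrite (lt_le_trans (archi_boundP _)) ?ler_nat // divr_ge0 // ltW.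
  have qd : (d %/ N.+1)%N%:R * N.+1%:R <= d%:R :> R by rewrite -natrM ler_nat leq_divM.
  have mR : m%:R <= 3 * (d %/ N.+1)%N%:R + C%:R :> R.
    by rewrite -natrM -natrD ler_nat.
  move: dC dN; rewrite ler_pdivrMr // ltr_pdivrMr // => dC dN.
  have q0 : 0 <= (d %/ N.+1)%N%:R :> R by [].
  nra.
(* [lambda] may be infinite a priori; the bound with [e = 1] makes the quotient eventually finite,
   after which the limit is one of real numbers. *)
apply/fine_cvgP; split.
  near=> d; have /andP[l0 l1] : (0 <= lambda R n d / d%:R%:E <= 1%:E)%E.
    by near: d; exact: key.
  by rewrite fin_numE; apply/andP; split; [apply: contraTneq l0 => ->|apply: contraTneq l1 => ->].
apply/cvgrPdist_le => e e0; near=> d.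
have /andP[l0 l1] : (0 <= lambda R n d / d%:R%:E <= e%:E)%E by near: d; exact: key.
rewrite sub0r normrN /=.
case: (lambda R n d / _)%E l0 l1 => [x| |] //=.
by rewrite !lee_fin => x0 x1; rewrite ger0_norm.
Unshelve. all: by end_near.
Qed.
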